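(* Let $n\geq 2$, let $r$ be a positive integer not divisible by $n$, let $k=r/n$, and let $d=\gcd(r,n)$. Let $M_k$ be the polynomial representation of the rational Cherednik algebra $H_k(n)=H_k(S_n)$, let $I_k\subset M_k$ be the $H_k(n)$-submodule generated by the functions $$f_i(x_1,\dots,x_n)=\operatorname{Res}_{z=\infty}\,[(z-x_1)\cdots(z-x_n)]^{\frac{r}{n}}\,\frac{dz}{z-x_i},\qquad i=1,\dots,n,$$ and let $V_k=M_k/I_k$, regarded as a $\mathbb{C}[\mathfrak{h}]$-module, where $\mathfrak{h}=\mathbb{C}^n/\Delta$ and $\Delta$ is the diagonal. Then the set-theoretical support of $V_k$ is the union of the $S_n$-translates of the subspace of $\mathbb{C}^n/\Delta$ defined by the equations $$x_1=x_2=\dots=x_{\frac nd};\quad x_{\frac nd+1}=\dots=x_{2\frac nd};\quad\dots;\quad x_{(d-1)\frac nd+1}=\dots=x_n .$$ In particular, the Gelfand–Kirillov dimension of $V_k$ is $d-1$.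
   Context: $S_n$ acts on its reflection representation $\mathfrak{h}=\mathbb{C}^n/\Delta$. The polynomial representation $M_k$ of the rational Cherednik algebra $H_k(n)$ of $S_n$ with parameter $k\in\mathbb{C}$ is the space $\mathbb{C}[\mathfrak{h}]=\mathbb{C}[x_1,\dots,x_n]^T$ of polynomials in $x_1,\dots,x_n$ invariant under simultaneous translation $x_i\mapsto x_i+a$. On it $S_n$ acts by permuting variables, elements of $\mathfrak{h}^*$ (translation-invariant linear forms) act by multiplication, and elements of $\mathfrak{h}$ act by the linear combinations of Dunkl operators $$\frac{\partial}{\partial x_i}-k\sum_{j\ne i}\frac{1}{x_i-x_j}(1-s_{ij}),$$ $s_{ij}$ being the transposition of $x_i$ and $x_j$ (the sum over $i$ of these operators acts by zero on $M_k$). Explicitly, $H_k(n)$ is the algebra generated by $S_n$, $\mathfrak{h}$, $\mathfrak{h}^*$ with $gxg^{-1}=x^g$, $gyg^{-1}=y^g$, $[x,x']=[y,y']=0$, $[y,x]=(y,x)-k\sum_{s}(y,\alpha_s)(\alpha_s^\vee,x)s$, the sum being over transpositions $s$ with root $\alpha_s\in\mathfrak{h}^*$ and coroot $\alpha_s^\vee\in\mathfrak{h}$, $(\alpha_s^\vee,\alpha_s)=2$. $\operatorname{Res}_\infty$ denotes the residue at infinity; the function $[(z-x_1)\cdots(z-x_n)]^{r/n}$ is expanded near $z=\infty$ as $z^r\prod_{j}(1-x_j/z)^{r/n}$. The $f_i$ are homogeneous of degree $r$, lie in $M_k$, and are singular vectors (killed by all $y\in\mathfrak{h}$); their span is a copy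 of the reflection representation of $S_n$ (a known result of Dunkl), so that $I_k$ is the ideal of $\mathbb{C}[\mathfrak{h}]$ generated by the $f_i$. *)

(* Defs.v *)
From HB Require Import structures.
From mathcomp Require Import all_boot all_order all_algebra all_fingroup.
From mathcomp Require Import complex.
From mathcomp Require Import boolp classical_sets reals ereal sequences exp.
(* The notations of mpoly are incompatible with those of mathcomp-analysis:
   [mpoly n C] is the ring usually written {mpoly C[n]}. *)
From mathcomp Require Import -(notations) mpoly.

Set Implicit Arguments.
Unset Strict Implicit.
Unset Printing Implicit Defensive.

Import Order.TTheory GRing.Theory Num.Theory.

(* fingroup has another repr *)
Local Notation repr := generic_quotient.repr.

Local Open Scope ring_scope.
Local Open Scope quotient_scope.
Local Open Scope classical_set_scope.

Section Polynomials.
Context (F : fieldType) (n : nat).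
Implicit Types (p : mpoly n F) (i j : 'I_n).

Definition xvar i : mpoly n F := mpolyX F (mnm1 i).

(* C[h] = C[x_1, ..., x_n]^T, invariants of x_i |-> x_i + a; as a vector space
   this is also the polynomial representation M_k *)
Definition transl_inv : set (mpoly n F) :=
  [set p | forall a : F,
     comp_mpoly [tuple xvar i + mpolyC n a | i < n] p = p].

Lemma divdiff_exists i j p :
  exists q, (xvar i - xvar j) * q == p - msym (tperm i j) p.
Proof.
pose D p := exists q, (xvar i - xvar j) * q == p - msym (tperm i j) p.
have D1 : D 1 by exists 0; rewrite mulr0 msym1 subrr.
have DM p1 p2 : D p1 -> D p2 -> D (p1 * p2).
  move=> [q1 /eqP h1] [q2 /eqP h2].
  exists (q1 * p2 + msym (tperm i j) p1 * q2); apply/eqP.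
  rewrite mulrDr mulrA h1 mulrCA h2 msymM mulrBl mulrBr addrA.
  by rewrite subrK.
have DX l : D (xvar l).
  have E : msym (tperm i j) (xvar l) = xvar (tperm i j l).
    by rewrite /msym /xvar mmapX mmap1U.
  rewrite /D E; case: tpermP => [->|->|_ _].
  - by exists 1; rewrite mulr1.
  - by exists (-1); rewrite mulrN1 opprB.
  - by exists 0; rewrite mulr0 subrr.
have Dm m : D (mpolyX F m).
  rewrite mpolyXE_id; elim/big_ind: _ => // l _.
  elim: (m l) => [|e IH]; first by rewrite expr0.
  by rewrite exprS; apply: (DM _ _ (DX l) IH).
change (D p); elim/mpolyind: p => [|c m p _ _ [q2 /eqP h2]].
  by exists 0; rewrite mulr0 raddf0 subrr.
have [q1 /eqP h1] := Dm m.
exists (c *: q1 + q2); apply/eqP.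
rewrite mulrDr -scalerAr h1 h2 msymD msymZ scalerBr opprD.
by rewrite addrACA.
Qed.

(* (p - s_ij p) / (x_i - x_j), as a polynomial *)
Definition divdiff i j p : mpoly n F := xchoose (divdiff_exists i j p).

Lemma divdiffP i j p :
  (xvar i - xvar j) * divdiff i j p = p - msym (tperm i j) p.
Proof. exact/eqP/(xchooseP (divdiff_exists i j p)). Qed.

Definition dunkl (k : F) i p : mpoly n F :=
  mderiv i p - k *: \sum_(j | j != i) divdiff i j p.

(* H_k(n) is generated by S_n, h^* and h.  An element of h = C^n / Delta is
   given by a representative y in C^n, since sum_i dunkl k i vanishes on M_k;
   an element of h^* is a linear form whose coefficients sum to zero. *)
Record cherednik_submodule (k : F) (N : set (mpoly n F)) : Prop :=
  CherednikSubmodule {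
    submod_sub : N `<=` transl_inv;
    submod0 : N 0;
    submodD : forall p q, N p -> N q -> N (p + q);
    submodZ : forall (c : F) p, N p -> N (c *: p);
    submod_perm : forall (s : 'S_n) p, N p -> N (msym s p);
    submod_hdual : forall (b : 'I_n -> F) p,
      \sum_i b i = 0 -> N p -> N ((\sum_i b i *: xvar i) * p);
    submod_h : forall (y : 'I_n -> F) p,
      N p -> N (\sum_i y i *: dunkl k i p) }.

(* A formal power series in w = 1/z is the sequence of its coefficients. *)
Definition series_one : nat -> mpoly n F := fun m => (m == 0%N)%:R.

Definition series_mul (a b : nat -> mpoly n F) : nat -> mpoly n F :=
  fun m => \sum_(l < m.+1) a l * b (m - l)%N.

Definition gbinomial (a : F) (m : nat) : F :=
  (\prod_(l < m) (a - l%:R)) / m`!%:R.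

(* (1 - x / z) ^ a *)
Definition binomial_series (a : F) (x : mpoly n F) : nat -> mpoly n F :=
  fun m => gbinomial a m *: (- x) ^+ m.

(* (1 - x / z) ^ (-1) *)
Definition geometric_series (x : mpoly n F) : nat -> mpoly n F :=
  fun m => x ^+ m.

(* Residue at z = oo of z ^ e * (sum_m a_m z ^ (- m)) dz, i.e. minus the
   coefficient of z ^ (-1), that is - a_(e + 1). *)
Definition res_infty (e : int) (a : nat -> mpoly n F) : mpoly n F :=
  if e + 1 is Posz m then - a m else 0.

(* [(z - x_1) ... (z - x_n)] ^ (r / n) / (z - x_i)
   = z ^ (r - 1) * \prod_j (1 - x_j / z) ^ (r / n) * (1 - x_i / z) ^ (-1) *)
Definition dunkl_singular (r : nat) i : mpoly n F :=
  res_infty (r%:Z - 1)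
    (series_mul
       (\big[series_mul/series_one]_(j < n)
          binomial_series (r%:R / n%:R) (xvar j))
       (geometric_series (xvar i))).

Definition submodule_I (r : nat) : set (mpoly n F) :=
  smallest (cherednik_submodule (r%:R / n%:R)) (range (dunkl_singular r)).

(* h = C^n / Delta *)
Definition diag_equiv (x y : 'rV[F]_n) : bool :=
  (x - y <= (const_mx 1 : 'rV[F]_n))%MS.

Lemma diag_equiv_refl : reflexive diag_equiv.
Proof. by move=> x; rewrite /diag_equiv subrr sub0mx. Qed.

Lemma diag_equiv_sym : ssrbool.symmetric diag_equiv.
Proof. by move=> x y; rewrite /diag_equiv -opprB eqmx_opp. Qed.

Lemma diag_equiv_trans : transitive diag_equiv.
Proof.
move=> y x z xy yz; rewrite /diag_equiv -(subrK y x) -addrA.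
exact: addmx_sub.
Qed.

Canonical diag_equivRel :=
  EquivRel diag_equiv diag_equiv_refl diag_equiv_sym diag_equiv_trans.

Definition hspace := {eq_quot diag_equiv}.

(* Only meaningful for p in C[h], where it does not depend on the
   representative (see evalhE). *)
Definition evalh p (u : hspace) : F := meval (fun i => repr u 0 i) p.

Lemma evalhE p (x : 'rV[F]_n) :
  transl_inv p -> evalh p (\pi_hspace x) = meval (fun i => x 0 i) p.
Proof.
move=> hp; rewrite /evalh.
have : diag_equiv (repr (\pi_hspace x)) x.
  by rewrite -(pi_eq_quot (s := hspace)) reprK.
case/sub_rVP => a ea; rewrite -{2}(hp a) comp_mpoly_meval.
apply: meval_eq => i; rewrite tnth_mktuple mevalD mevalXU mevalC.
by move/rowP/(_ i): ea; rewrite !mxE mulr1 => <-; rewrite addrCA subrr addr0.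
Qed.

Definition act_hspace (s : 'S_n) (u : hspace) : hspace :=
  \pi_hspace (col_perm s (repr u)).

(* x_1 = ... = x_(n/d), x_(n/d+1) = ... = x_(2n/d), ... (0-based indices) *)
Definition block_subspace (d : nat) : set hspace :=
  [set \pi_hspace x | x in [set x : 'rV[F]_n |
     forall i j, (i %/ (n %/ d) = j %/ (n %/ d))%N -> x 0 i = x 0 j]].

(* Set of closed points u of h = Spec C[h] at which the localization of the
   C[h]-module M / I is nonzero, i.e. some class v mod I is not killed by any
   g in C[h] that is nonzero at u. *)
Definition quot_support (M I : set (mpoly n F)) : set hspace :=
  [set u | exists2 v, M v &
     forall g, transl_inv g -> evalh g u != 0 -> ~ I (g * v)].

Definition free_mod (I : set (mpoly n F)) (s : seq (mpoly n F))
    (B : {set 'I_(size s)}) : Prop :=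
  forall c : 'I_(size s) -> F,
    I (\sum_(t in B) c t *: s`_t) -> forall t, t \in B -> c t = 0.

(* dimension of the image of span(s) in the quotient by I *)
Definition dim_mod (I : set (mpoly n F)) (s : seq (mpoly n F)) : nat :=
  (\max_(B : {set 'I_(size s)} | `[< free_mod I B >]) #|B|)%N.

(* spanning family of W ^ m * span(e), where W = span(1, w) *)
Definition power_family (w e : seq (mpoly n F)) (m : nat) : seq (mpoly n F) :=
  iter m (fun s => [seq a * b | a <- 1 :: w, b <- s]) e.

End Polynomials.

(* Gelfand-Kirillov dimension of the C[h]-module M / I: the supremum, over the
   finite-dimensional subspaces W of C[h] containing 1 and E of M / I, of
   limsup_m log (dim (W ^ m E)) / log m. *)
Definition gk_dim (R : realType) (n : nat) (M I : set (mpoly n R[i])) : \bar R :=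
  ereal_sup [set g | exists w e : seq (mpoly n R[i]),
    [/\ forall p, p \in w -> transl_inv p,
        forall p, p \in e -> M p &
        g = limn_esup (fun m : nat =>
              lne (dim_mod I (power_family w e m))%:R%:E *
              ((ln m%:R)^-1)%:E)%E]].

(* Main.v *)
From HB Require Import structures.
Require Import Defs.
From mathcomp Require Import all_boot all_order all_algebra all_fingroup.
From mathcomp Require Import ring_quotient complex ring zify.
From mathcomp Require Import boolp classical_sets reals ereal sequences exp.
From mathcomp Require Import topology normedtype.
From mathcomp Require Import -(notations) mpoly.

(** Let P(z) = (z - x_1) ... (z - x_n), and expand P^(r/n) at infinity as
    z^r (c_0 + c_1 / z + c_2 / z^2 + ...), where c_t is a symmetric polynomial
    of degree t in the x_j.  Expanding 1 / (z - x_i) as well, f_i is minus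
    sum_(l <= r) c_l x_i^(r - l), that is - Q(x_i), where Q is the polynomial
    part of P^(r/n).  All that is used about the c_t is c_0 = 1 and the
    recurrence that the logarithmic derivative of P^(r/n) gives
    ([singular_coef_newton]); it makes sense in any commutative ring.

    The submodule.  The Dunkl operators kill every f_i: for D_j f_i with
    j <> i the derivative and the divided difference are the residues of the
    same function with opposite signs, and D_i f_i is the residue of a
    derivative ([dunkl_singular_kill]).  As S_n permutes the f_i, the Leibniz
    rule for Dunkl operators shows that the ideal of C[h] generated by the f_i
    is already a submodule, hence equals I_k ([submodule_IE]).

    The zeros of I_k.  If Q vanishes at every root x_j of P, then Q / (z - x_j)
    is a polynomial, and the recurrence says precisely that
    n Q' = r sum_j Q / (z - x_j), i.e. n Q' / Q = r P' / P.  Comparing orders at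
    a root y gives n mult_y(Q) = r mult_y(P), so n / d divides every
    multiplicity of P ([roots_multiplicity]).  Conversely, if it does, P^(r/n)
    is a polynomial, equal to Q by uniqueness of the solution of the
    recurrence, and it vanishes at the x_j ([multiplicity_roots]).  Over C this
    is the statement about the support; but the argument is valid over every
    integral domain of characteristic zero, and this is what gives the
    dimension.

    The dimension.  Restricting functions to the block subspace, on which d - 1
    coordinates are independent, bounds the growth from below
    ([dim_mod_lower]).  For the upper bound, C[h] / I_k is a finite module over
    the algebra generated by the power sums p_2, ..., p_d of the centred
    variables.  To see this, add the power sums p_1, ..., p_d of the x_i to the
    ideal.  In an integral domain where all these elements vanish, the x_j take
    at most d distinct values by the previous paragraph, and d power sums that
    vanish on at most d values force all the values to be 0.  So each x_i lies
    in every prime ideal containing the enlarged ideal, and is nilpotent modulo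
    it ([xvar_nilpotent]).  By homogeneity, a power x_i^N is then a combination
    of the f_j and of products p_l h with h of smaller degree; an induction on
    the degree shows that, modulo I_k, the polynomials of degree m are spanned
    by products of at most m power sums of each kind with boundedly many
    monomials ([center_span]), which is O(m^(d - 1)) elements. *)

Set Implicit Arguments.
Unset Strict Implicit.
Unset Printing Implicit Defensive.

Import Order.TTheory GRing.Theory Num.Theory.

Local Notation repr := generic_quotient.repr.

Local Open Scope ring_scope.
Local Open Scope quotient_scope.
Local Open Scope classical_set_scope.

(** * The Newton recurrence and its zeros *)

Section NewtonRecurrence.
Context (K : comNzRingType) (n : nat) (x : 'I_n -> K) (c : nat -> K) (a : K).

(** The coefficient of w^t in c(w) / (1 - x_i w), for the series
    c(w) = sum_t c_t w^t; it is also the value at x_i of the polynomial part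
    sum_(l <= t) c_l z^(t - l) of z^t c(1/z). *)
Definition pole_coef i t := \sum_(l < t.+1) c l * x i ^+ (t - l).

(** The coefficient of w^t in c(w) / ((1 - x_i w) (1 - x_j w)), a divided
    difference of the previous coefficients ([pole_coef_diff]). *)
Fixpoint pole2_coef i j t :=
  if t is t'.+1 then pole_coef i t + x j * pole2_coef i j t' else c 0.

(** The differential equation c' = - a sum_j x_j c / (1 - x_j w), whose
    solution with c_0 = 1 is the product of the (1 - x_j w)^a. *)
Definition newton_recurrence :=
  forall t, t.+1%:R * c t.+1 = - a * \sum_j x j * pole_coef j t.

Lemma pole_coef0 i : pole_coef i 0 = c 0.
Proof. by rewrite /pole_coef big_ord1 subn0 expr0 mulr1. Qed.

Lemma pole_coefS i t : pole_coef i t.+1 = c t.+1 + x i * pole_coef i t.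
Proof.
rewrite /pole_coef big_ord_recr /= subnn mulr1 addrC mulr_sumr; congr (_ + _).
apply: eq_bigr => l _; rewrite subSn ?exprS 1?mulrCA //.
by rewrite -ltnS ltn_ord.
Qed.

Lemma pole2_coefS i j t : pole2_coef i j t.+1 = pole_coef i t.+1 + x j * pole2_coef i j t.
Proof. by []. Qed.

Lemma pole_coef_diff i j t :
  (x i - x j) * pole2_coef i j t = pole_coef i t.+1 - pole_coef j t.+1.
Proof.
elim: t => [|t IH]; first by rewrite !pole_coefS !pole_coef0 /=; ring.
rewrite pole2_coefS mulrDr mulrCA IH !(pole_coefS _ t.+1); ring.
Qed.

Lemma pole2_coefC i j t : pole2_coef i j t = pole2_coef j i t.
Proof.
elim: t => [//|t IH]; apply/eqP; rewrite -subr_eq0 !pole2_coefS -IH.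
have := pole_coef_diff i j t => E.
have -> : pole_coef i t.+1 + x j * pole2_coef i j t -
    (pole_coef j t.+1 + x i * pole2_coef i j t)
  = pole_coef i t.+1 - pole_coef j t.+1 - (x i - x j) * pole2_coef i j t by ring.
by rewrite E subrr.
Qed.

Hypothesis rec_c : newton_recurrence.

(** The logarithmic derivative of c(w) / (1 - x_i w), which is the recurrence
    for the product of c(w) with one more factor. *)
Lemma euler_pole_coef i t :
  t.+1%:R * pole_coef i t.+1 = - a * \sum_j x j * pole2_coef i j t + x i * pole2_coef i i t.
Proof.
elim: t => [|t IH].
  rewrite pole_coefS mulrDr rec_c pole_coef0 /= mul1r; congr (_ * _ + _).
  by apply: eq_bigr => j _; rewrite pole_coef0.
rewrite pole_coefS mulrDr rec_c mulrCA -[t.+2]add1n natrD mulrDl mul1r IH.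
under eq_bigr => j _.
  rewrite (_ : pole_coef j t.+1 = pole2_coef i j t.+1 - x i * pole2_coef i j t).
    rewrite mulrBr [x j * (x i * _)]mulrCA; over.
  by rewrite (pole2_coefC i j t.+1) pole2_coefS (pole2_coefC i j) addrK.
rewrite sumrB -mulr_sumr pole2_coefS; ring.
Qed.

(** When a n = t + 1 the left-hand side vanishes: the right-hand side is then
    the residue of the derivative of P^a / (z - x_i).  This is what makes
    the residues of P^(r/n) / (z - x_i) singular vectors. *)
Lemma residue_of_derivative i t :
  (t.+1%:R - a * n%:R) * pole_coef i t = pole2_coef i i t - a * \sum_j pole2_coef i j t.
Proof.
case: t => [|t].
  by rewrite pole_coef0 /= sumr_const card_ord -mulr_natl; ring.
under eq_bigr do rewrite pole2_coefS.
rewrite big_split /= sumr_const card_ord -mulr_natl.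
have /eqP := euler_pole_coef i t; rewrite -subr_eq0 => /eqP E.
rewrite -[t.+2]addn1 natrD; apply/eqP; rewrite -subr_eq0 -[X in _ == X]E.
by apply/eqP; ring.
Qed.

End NewtonRecurrence.

(** In characteristic zero the factor t + 1 can be cancelled, so the recurrence
    determines the sequence, as far as it holds, from its value at 0. *)
Lemma newton_recurrence_uniq (K : idomainType) n (x : 'I_n -> K) (a : K)
    (c c' : nat -> K) m :
  [pchar K] =i pred0 -> c 0 = c' 0 -> newton_recurrence x c a ->
  (forall t, (t < m)%N -> t.+1%:R * c' t.+1 = - a * \sum_j x j * pole_coef x c' j t) ->
  forall t, (t <= m)%N -> c t = c' t.
Proof.
move=> /pcharf0P chK c0 E E'; elim/ltn_ind => -[//|t] IH tm.
apply: (mulfI (x := t.+1%:R)); first by rewrite chK.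
rewrite E E' //; congr (_ * _); apply: eq_bigr => j _; congr (_ * _).
apply: eq_bigr => l _; rewrite IH // ltnW // (leq_trans (ltn_ord l)) //.
Qed.

Lemma natr_inj (K : idomainType) : [pchar K] =i pred0 -> injective (fun m => m%:R : K).
Proof.
move=> /pcharf0P chK; suff H p q : (p <= q)%N -> p%:R = q%:R :> K -> p = q.
  by move=> p q; case/orP: (leq_total p q) => /H // h /esym /h.
move=> pq /eqP; rewrite eq_sym -subr_eq0 -natrB // chK => qp.
by apply/eqP; rewrite eqn_leq pq.
Qed.

Lemma deriv_factor (K : comNzRingType) (y : K) e (q : {poly K}) :
  ('X - y%:P) * (('X - y%:P) ^+ e * q)^`() =
  ('X - y%:P) ^+ e * (e%:R * q + ('X - y%:P) * q^`()).
Proof.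
rewrite derivM deriv_exp derivXsubC mul1r; case: e => [|e].
  by rewrite expr0 mulr0n !mul0r !mul1r !add0r.
by rewrite exprS -mulr_natl /=; ring.
Qed.

Section ZeroSet.
Context (K : idomainType) (n r : nat) (x : 'I_n -> K).
Hypothesis r0 : (0 < r)%N.

Section Quotients.
Variable c : nat -> K.

(** The polynomial part Q of z^r c(1/z). *)
Definition poly_part : {poly K} := \poly_(l < r.+1) c (r - l).

(** The quotient of the previous polynomial by z - x_j, when x_j is a root. *)
Definition quot_poly j : {poly K} := \poly_(l < r) pole_coef x c j (r.-1 - l).

Lemma horner_poly_part j : poly_part.[x j] = pole_coef x c j r.
Proof.
rewrite horner_poly /pole_coef (reindex_inj rev_ord_inj) /=.
apply: eq_bigr => l _; rewrite subSS subKn //.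
by rewrite -ltnS ltn_ord.
Qed.

Lemma quot_polyP j : pole_coef x c j r = 0 ->
  ('X - (x j)%:P) * quot_poly j = poly_part.
Proof.
move=> hj; apply/polyP => l; rewrite mulrBl coefB coefXM coefCM !coef_poly.
case: l => [|l] /=.
  rewrite r0 sub0r.
  move: hj; rewrite -{1}(prednK r0) pole_coefS prednK // => /eqP.
  by rewrite !subn0 addr_eq0 => /eqP ->.
rewrite ltnS; case: ltnP => lr; last by rewrite ltnNge (leq_trans lr _) ?leqnSn // mulr0 subrr.
case: ltnP => lr'.
  have -> : (r.-1 - l)%N = (r.-1 - l.+1).+1 by lia.
  by rewrite pole_coefS addrK; congr (c _); lia.
have -> : l = r.-1 by lia.
by rewrite subnn pole_coef0 mulr0 subr0; congr (c _); lia.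
Qed.

End Quotients.

Definition root_poly : {poly K} := \prod_(y <- codom x) ('X - y%:P).

Lemma root_polyE : root_poly = \prod_j ('X - (x j)%:P).
Proof. by rewrite /root_poly big_image. Qed.

Lemma root_poly_undup :
  root_poly = \prod_(y <- undup (codom x)) ('X - y%:P) ^+ count_mem y (codom x).
Proof. by rewrite /root_poly -big_undup_iterop_count. Qed.

Lemma root_poly_count y : exists2 g : {poly K}, ~~ root g y &
  root_poly = ('X - y%:P) ^+ count_mem y (codom x) * g.
Proof.
rewrite /root_poly (bigID (pred1 y)) /=.
exists (\prod_(z <- codom x | z != y) ('X - z%:P)).
  by rewrite /root horner_prod prodf_seq_neq0; apply/allP => z _;
    apply/implyP; rewrite hornerXsubC subr_eq0 eq_sym.
congr (_ * _); rewrite (eq_bigr (fun=> 'X - y%:P)); last by move=> z /eqP ->.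
by rewrite big_const_seq -Monoid.iteropE.
Qed.

Lemma deriv_root_poly (q : 'I_n -> {poly K}) p :
  (forall j, ('X - (x j)%:P) * q j = p) -> root_poly^`() * p = root_poly * \sum_j q j.
Proof.
move=> H; rewrite root_polyE; elim: (index_enum _) => [|j s IH].
  by rewrite !big_nil -polyC1 derivC !mul0r mulr0.
rewrite !big_cons derivM derivXsubC mul1r mulrDl -mulrA IH mulrDr.
by rewrite -{1}(H j); ring.
Qed.

(** The polynomial q is P^(r/n), obtained by giving each root y of P the
    multiplicity r mult_y(P) / n. *)
Lemma multiplicity_root_power :
  (forall y, exists e, (n * e = r * count_mem y (codom x))%N) ->
  exists2 q : {poly K}, q \is monic /\ q ^+ n = root_poly ^+ r &
    forall j, root q (x j).
Proof.
move=> H; have n0 (j : 'I_n) : (0 < n)%N by apply: leq_ltn_trans (ltn_ord j).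
pose e (y : K) := (r * count_mem y (codom x) %/ n)%N.
have eP (j : 'I_n) y : (n * e y = r * count_mem y (codom x))%N.
  by have [e' E] := H y; rewrite /e -E mulKn ?(n0 j).
exists (\prod_(y <- undup (codom x)) ('X - y%:P) ^+ e y).
  split; first by apply: monic_prod => y _; apply/monic_exp/monicXsubC.
  rewrite root_poly_undup -!prodrXl !big_seq; apply: eq_bigr => y.
  rewrite mem_undup => /codomP[j ->].
  by rewrite -!exprM mulnC (eP j) mulnC.
move=> j; have yS : x j \in undup (codom x) by rewrite mem_undup codom_f.
have: (0 < n * e (x j))%N.
  by rewrite (eP j) muln_gt0 r0 -has_count has_pred1 codom_f.
rewrite muln_gt0 => /andP[_]; rewrite (big_rem _ yS) rootM /=.
by case: (e _) => // e' _; rewrite exprS rootM root_XsubC eqxx.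
Qed.

Section Residues.
Variables (c : nat -> K) (a : K).
Hypothesis chK : [pchar K] =i pred0.
Hypothesis rn : n%:R * a = r%:R.
Hypothesis c0 : c 0 = 1.
Hypothesis rec_c : newton_recurrence x c a.

(** Coefficientwise, this identity is the recurrence multiplied by n; it states
    that n Q' = r sum_j Q / (z - x_j) as soon as Q vanishes at every x_j. *)
Lemma deriv_poly_part : n%:R *: (poly_part c)^`() = r%:R *: \sum_j quot_poly c j.
Proof.
apply/polyP => l; rewrite coefZ coef_deriv coef_poly coefZ coef_sum ltnS.
under eq_bigr do rewrite coef_poly.
case: ltnP => lr; last by rewrite mul0rn mulr0 big1_eq mulr0.
set t := (r.-1 - l)%N.
have Et : (r - l.+1)%N = t by rewrite /t -{1}(prednK r0) subSS.
rewrite Et.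
have H : \sum_j pole_coef x c j t = n%:R * c t +
    \sum_j x j * (if t is t'.+1 then pole_coef x c j t' else 0).
  case: t {Et} => [|t].
    under eq_bigr do rewrite pole_coef0.
    under [X in _ = _ + X]eq_bigr do rewrite mulr0.
    by rewrite big1_eq addr0 sumr_const card_ord mulr_natl.
  by under eq_bigr do rewrite pole_coefS; rewrite big_split /= sumr_const card_ord mulr_natl.
have H2 : r%:R * (\sum_j x j * (if t is t'.+1 then pole_coef x c j t' else 0)) =
    - (n%:R * t%:R * c t).
  case: (t) => [|t'].
    under eq_bigr do rewrite mulr0.
    by rewrite big1_eq mulr0 mulr0 mul0r oppr0.
  by rewrite -mulrA rec_c -rn; ring.
rewrite H mulrDr H2 -[_ *+ l.+1]mulr_natl.
have -> : l.+1%:R = r%:R - t%:R :> K.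
  by rewrite -natrB; [congr (_%:R); rewrite -Et subKn | rewrite -Et leq_subr].
ring.
Qed.

Lemma poly_part_monic : poly_part c \is monic.
Proof.
rewrite monicE lead_coefE size_poly_eq; last by rewrite subnn c0 oner_neq0.
by rewrite /= coef_poly ltnSn subnn c0.
Qed.

(** At a root y, both sides of n P Q' = r P' Q vanish to the order of P Q minus
    one, and the leading coefficients there are proportional to n mult_y(Q)
    and r mult_y(P). *)
Lemma roots_multiplicity : (forall j, pole_coef x c j r = 0) ->
  forall y, exists e, (n * e = r * count_mem y (codom x))%N.
Proof.
move=> hz y; have hq j := quot_polyP (hz j).
have D := deriv_root_poly hq.
have D2 : n%:R *: (root_poly * (poly_part c)^`()) = r%:R *: (root_poly^`() * (poly_part c)).
  by rewrite D scalerAr deriv_poly_part scalerAr.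
have Qn0 : (poly_part c) != 0 by apply: monic_neq0; apply: poly_part_monic.
(* e and the multiplicity p of y in P are read off at order p + e *)
have [e [q qy EQ]] := multiplicity_XsubC (poly_part c) y.
rewrite Qn0 /= in qy.
have [g gy EP] := root_poly_count y.
set p := count _ _ in EP *; exists e.
apply/(natr_inj chK).
rewrite mulrC in EQ.
have {}D2 : n%:R * (root_poly * (('X - y%:P) * (poly_part c)^`())) =
    r%:R * ((('X - y%:P) * root_poly^`()) * (poly_part c)).
  transitivity (('X - y%:P) * (n%:R *: (root_poly * (poly_part c)^`()))).
    by rewrite scaler_nat -mulr_natl; ring.
  by rewrite D2 scaler_nat -mulr_natl; ring.
have LHS : n%:R * (root_poly * (('X - y%:P) * (poly_part c)^`())) =
   ('X - y%:P) ^+ (p + e) * (n%:R * g * (e%:R * q + ('X - y%:P) * q^`())).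
  by rewrite EP EQ deriv_factor exprD; ring.
have RHS : r%:R * ((('X - y%:P) * root_poly^`()) * (poly_part c)) =
   ('X - y%:P) ^+ (p + e) * (r%:R * q * (p%:R * g + ('X - y%:P) * g^`())).
  by rewrite EP EQ deriv_factor exprD; ring.
move: D2; rewrite LHS RHS => /mulfI.
rewrite expf_neq0 ?polyXsubC_eq0 // => /(_ isT) /(congr1 (fun f => f.[y])).
rewrite !(hornerXsubC, hornerM, hornerD, subrr, mul0r, addr0).
rewrite -!polyC_natr !hornerC !natrM => E.
apply: (mulIf (x := g.[y] * q.[y])); first by rewrite mulf_neq0.
by transitivity (n%:R * g.[y] * (e%:R * q.[y])); [ring | rewrite E; ring].
Qed.




(** Differentiating q^n = P^r shows that the coefficients of q, read from the
    top, satisfy the recurrence up to degree r, so q is the polynomial part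
    of the series. *)
Lemma multiplicity_roots :
  (forall y, exists e, (n * e = r * count_mem y (codom x))%N) ->
  forall j, pole_coef x c j r = 0.
Proof.
move=> /multiplicity_root_power [q [qm qn] qr] j0.
have n0 : (0 < n)%N := leq_ltn_trans (leq0n _) (ltn_ord j0).
have nK : n%:R != 0 :> K by have /pcharf0P -> := chK; rewrite -lt0n.
have Pm : root_poly \is monic by apply: monic_prod_XsubC.
have sP : size root_poly = n.+1.
  by rewrite /root_poly size_prod_XsubC size_codom card_ord.
have sq : size q = r.+1.
  have := congr1 (fun p : {poly K} => (size p).-1) qn.
  rewrite !size_exp sP /= mulnC => /eqP; rewrite eqn_pmul2l // => /eqP <-.
  by rewrite prednK // lt0n size_poly_eq0 monic_neq0.
(* the coefficients of q, from the leading one down *)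
pose c' t := q`_(r - t).
have Eq : poly_part c' = q.
  apply/polyP => l; rewrite coef_poly ltnS; case: leqP => lr.
    by rewrite /c' subKn.
  by rewrite nth_default // sq.
have h'0 j : pole_coef x c' j r = 0.
  by rewrite -horner_poly_part // Eq; apply/rootP.
have qq j := quot_polyP (h'0 j).
rewrite Eq in qq.
have D := deriv_root_poly qq.
have {}D : n%:R * q^`() = r%:R * \sum_j quot_poly c' j.
  have X0 : root_poly ^+ r * root_poly != 0.
    by rewrite mulf_neq0 ?expf_neq0 // monic_neq0.
  apply: (mulfI X0).
  have := congr1 (fun p => p^`() * (q * root_poly)) qn.
  rewrite !deriv_exp -[_ *+ n]mulr_natl -[_ *+ r]mulr_natl.
  have Er : r = r.-1.+1 by rewrite prednK.
  have En : n = n.-1.+1 by rewrite prednK.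
  have Xr : root_poly ^+ r = root_poly * root_poly ^+ r.-1 by rewrite {1}Er exprS.
  have Xn : root_poly ^+ r = q * q ^+ n.-1 by rewrite -qn {1}En exprS.
  move=> H.
  transitivity (n%:R * (q^`() * q ^+ n.-1) * (q * root_poly)).
    by rewrite Xn; ring.
  rewrite H Xr; transitivity (r%:R * root_poly * root_poly ^+ r.-1 * (root_poly^`() * q)).
    by ring.
  by rewrite D; ring.
have D2 t : (t < r)%N -> n%:R * ((r%:R - t%:R) * c' t) = r%:R * \sum_j pole_coef x c' j t.
  move=> tr; have := congr1 (fun p : {poly K} => p`_(r.-1 - t)) D.
  rewrite !mulr_natl !coefMn coef_deriv coef_sum.
  under eq_bigr do rewrite coef_poly.
  have -> : (r.-1 - t < r)%N by lia.
  have -> : (r.-1 - (r.-1 - t) = t)%N by lia.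
  have -> : (r.-1 - t).+1 = (r - t)%N by lia.
  by rewrite -[_ *+ (r - t)]mulr_natl natrB 1?ltnW // !mulr_natl.
have EE t : (t < r)%N -> t.+1%:R * c' t.+1 = - a * \sum_j x j * pole_coef x c' j t.
  have S : \sum_j pole_coef x c' j t.+1 = n%:R * c' t.+1 + \sum_j x j * pole_coef x c' j t.
    under eq_bigr do rewrite pole_coefS.
    by rewrite big_split sumr_const card_ord mulr_natl.
  rewrite leq_eqVlt => /orP[/eqP tr|tr].
    (* the last step t + 1 = r is the vanishing of q at the roots of P *)
    have S0 : \sum_j pole_coef x c' j t.+1 = 0 by rewrite tr big1.
    move/eqP: S; rewrite S0 eq_sym addr_eq0 => /eqP S.
    have Et : t.+1%:R = n%:R * a :> K by rewrite rn tr.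
    by rewrite -[\sum_j _]opprK -S Et; ring.
  have := D2 _ tr; rewrite S -rn => H; apply: (mulfI nK).
  apply/eqP; rewrite -subr_eq0; apply/eqP.
  transitivity (n%:R * a * (n%:R * c' t.+1 + \sum_j x j * pole_coef x c' j t) -
    n%:R * ((n%:R * a - t.+1%:R) * c' t.+1)); first by ring.
  by rewrite H subrr.
have cE : forall t, (t <= r)%N -> c t = c' t.
  apply: newton_recurrence_uniq chK _ rec_c EE; rewrite c0 /c' subn0.
  by move/monicP: qm; rewrite lead_coefE sq.
rewrite -(h'0 j0); apply: eq_bigr => l _; rewrite cE //.
by rewrite -ltnS.
Qed.

End Residues.
End ZeroSet.

(** * The series of P^(r/n) and the polynomials f_i *)

Section FormalSeries.
Context (F : fieldType) (n : nat).
Local Notation A := (mpoly n F).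
Implicit Types a b c : nat -> A.

Definition truncate N a : {poly A} := \poly_(l < N) a l.

(** Truncations of formal series are multiplied as polynomials, so only the low
    coefficients of the factors may be compared. *)
Lemma coef_mul_eq (p p' q q' : {poly A}) m :
  (forall l, (l <= m)%N -> p`_l = p'`_l) -> (forall l, (l <= m)%N -> q`_l = q'`_l) ->
  (p * q)`_m = (p' * q')`_m.
Proof.
move=> hp hq; rewrite !coefM; apply: eq_bigr => l _.
by rewrite hp ?hq ?leq_subr // -ltnS.
Qed.

Lemma series_mulE N a b m : (m < N)%N -> series_mul a b m = (truncate N a * truncate N b)`_m.
Proof.
move=> mN; rewrite coefM; apply: eq_bigr => l _; rewrite !coef_poly.
have lm : (l <= m)%N by rewrite -ltnS.
by rewrite (leq_ltn_trans lm mN) (leq_ltn_trans (leq_subr l m) mN).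
Qed.

Lemma series_mulC a b m : series_mul a b m = series_mul b a m.
Proof. by rewrite !(@series_mulE m.+1) // mulrC. Qed.

Lemma series_mulA a b c m :
  series_mul a (series_mul b c) m = series_mul (series_mul a b) c m.
Proof.
rewrite !(@series_mulE m.+1) //.
transitivity ((truncate m.+1 a * (truncate m.+1 b * truncate m.+1 c))`_m).
  apply: coef_mul_eq => // l lm.
  by rewrite coef_poly ltnS lm (@series_mulE m.+1).
rewrite mulrA; apply: coef_mul_eq => // l lm.
by rewrite [RHS]coef_poly ltnS lm (@series_mulE m.+1).
Qed.

Lemma eq_series_mul a a' b b' : a =1 a' -> b =1 b' -> series_mul a b =1 series_mul a' b'.
Proof. by move=> ha hb m; apply: eq_bigr => l _; rewrite ha hb. Qed.

Definition series_deriv a : nat -> A := fun m => m.+1%:R * a m.+1.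

Lemma series_leibniz a b m : series_deriv (series_mul a b) m =
  series_mul (series_deriv a) b m + series_mul a (series_deriv b) m.
Proof.
rewrite /series_deriv (@series_mulE m.+2) // mulr_natl -coef_deriv derivM coefD.
congr (_ + _); rewrite (@series_mulE m.+1) //; apply: coef_mul_eq => l lm;
  by rewrite ?coef_deriv !coef_poly !ltnS ?lm ?mulr_natl // ltnW.
Qed.

Lemma gbinomialS (a : F) m : [pchar F] =i pred0 ->
  m.+1%:R * gbinomial a m.+1 = (a - m%:R) * gbinomial a m.
Proof.
move=> /pcharf0P ch; rewrite /gbinomial big_ord_recr /= factS natrM.
have h1 : m.+1%:R != 0 :> F by rewrite ch.
have h2 : m`!%:R != 0 :> F by rewrite ch -lt0n fact_gt0.
move: h1 h2; move: (m.+1%:R) (m`!%:R) (m%:R) => u v w h1 h2.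
by field; rewrite h1 h2.
Qed.

(** The differential equation of one factor (1 - x w)^a. *)
Lemma binomial_series_deriv (al : F) (x : A) m : [pchar F] =i pred0 ->
  series_deriv (binomial_series al x) m =
  - al%:A * (x * series_mul (binomial_series al x) (geometric_series x) m).
Proof.
move=> ch; set b := binomial_series al x.
have Db l : series_deriv b l = (al - l%:R)%:A * (- x * b l).
  rewrite /series_deriv /b /binomial_series exprS mulr_natl -scaler_nat scalerA.
  by rewrite gbinomialS // -scalerA mulr_algl -scalerAr.
elim: m => [|m IH].
  by rewrite Db /series_mul big_ord1 /geometric_series !expr0 subr0; ring.
have HS : series_mul b (geometric_series x) m.+1 =
   b m.+1 + x * series_mul b (geometric_series x) m.
  rewrite /series_mul big_ord_recr /= subnn /geometric_series expr0 mulr1 addrC.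
  congr (_ + _); rewrite mulr_sumr; apply: eq_bigr => l _.
  by rewrite subSn ?exprS 1?mulrCA // -ltnS.
rewrite HS mulrDr mulrDr mulrCA [_ * (x * (x * _))]mulrCA -IH Db /series_deriv.
rewrite scalerBl scaler_nat; ring.
Qed.

End FormalSeries.

Section SingularCoefficients.
Context (F : fieldType) (n : nat).
Hypothesis ch : [pchar F] =i pred0.
Local Notation A := (mpoly n F).
Local Notation x := (@xvar F n).
Local Notation homog t := (@ishomog1 n F t (@mdeg n)).

(** The coefficients c_t of the product of the (1 - x_j w)^a, with w = 1/z. *)
Definition singular_coef (al : F) : nat -> A :=
  \big[@series_mul F n/@series_one F n]_(j < n) binomial_series al (x j).

Variable al : F.
Local Notation c := (singular_coef al).


Lemma singular_coef0 : c 0 = 1.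
Proof.
rewrite /singular_coef; elim/big_ind: _ => [|a b a0 b0|j _].
- by rewrite /series_one eqxx.
- by rewrite /series_mul big_ord1 subn0 a0 b0 mulr1.
- by rewrite /binomial_series /gbinomial big_ord0 expr0 fact0 divr1 scale1r.
Qed.

(** The logarithmic derivative of a product is the sum of those of its
    factors. *)
Lemma singular_coef_newton : newton_recurrence x c al%:A.
Proof.
move=> t; rewrite /singular_coef.
have H : forall (s : seq 'I_n) m,
  let C := \big[@series_mul F n/@series_one F n]_(j <- s) binomial_series al (x j) in
  series_deriv C m =
  - al%:A * \sum_(j <- s) x j * series_mul C (geometric_series (x j)) m.
  elim=> [|j s IH] m /=.
    by rewrite !big_nil mulr0 /series_deriv /series_one mulr0.
  rewrite !big_cons series_leibniz.
  set B := binomial_series _ _; set C := \big[_/_]_(_ <- s) _.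
  have E1 : series_mul (series_deriv B) C m =
    - al%:A * (x j * series_mul (series_mul B C) (geometric_series (x j)) m).
    rewrite -series_mulA (@eq_series_mul _ _ B B _ (series_mul (geometric_series (x j)) C)) //;
      last exact: series_mulC.
    rewrite series_mulA mulrA mulr_sumr; apply: eq_bigr => l _.
    by rewrite binomial_series_deriv // !mulrA.
  have E2 : series_mul B (series_deriv C) m =
     - al%:A * \sum_(i <- s) x i * series_mul (series_mul B C) (geometric_series (x i)) m.
    rewrite (@eq_series_mul _ _ B B (series_deriv C) (fun m =>
      - al%:A * \sum_(i <- s) x i * series_mul C (geometric_series (x i)) m)) //.
    rewrite {1}/series_mul; under eq_bigr do rewrite mulrCA mulr_sumr.
    rewrite -mulr_sumr exchange_big; congr (_ * _); apply: eq_bigr => i _.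
    rewrite -series_mulA mulr_sumr; apply: eq_bigr => l _.
    by rewrite mulrCA.
  by rewrite E1 E2 mulrDr.
exact: (H (index_enum 'I_n) t).
Qed.

Lemma dunkl_singularE r i : (0 < r)%N ->
  dunkl_singular F r i = - pole_coef x (singular_coef (r%:R / n%:R)) i r.
Proof.
move=> r0; rewrite /dunkl_singular /res_infty.
by rewrite subrK.
Qed.

Lemma msym_xvar s i : msym s (x i) = x (s i).
Proof. by rewrite /msym /xvar mmapX mmap1U. Qed.

(** The recurrence expresses c_(t + 1) by the previous coefficients and the
    variables, so that properties such as symmetry and homogeneity propagate
    along it. *)
Lemma newton_ind (P : nat -> A -> Prop) : P 0 1 ->
  (forall t, (forall m, (m <= t)%N -> P m (c m)) ->
     P t.+1 (t.+1%:R^-1 *: (- al *: \sum_j x j * pole_coef x c j t))) ->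
  forall t, P t (c t).
Proof.
move=> P0 PS; elim/ltn_ind => -[|t] IH; first by rewrite singular_coef0.
have -> : c t.+1 = t.+1%:R^-1 *: (- al *: \sum_j x j * pole_coef x c j t).
  have := singular_coef_newton t; rewrite -scaleNr mulr_algl => <-.
  have /pcharf0P h := ch.
  by rewrite mulr_natl -scaler_nat scalerA mulVf ?scale1r // h.
by apply: PS => m mt; apply: IH.
Qed.

Lemma singular_coef_sym s t : msym s (c t) = c t.
Proof.
move: t; apply: (newton_ind (P := fun _ p => msym s p = p)) => [|t IH]; first exact: msym1.
rewrite !msymZ (raddf_sum (msym s)) [in RHS](reindex_inj (@perm_inj _ s)).
do 2!congr (_ *: _).
apply: eq_bigr => j _; rewrite /= msymM msym_xvar; congr (_ * _).
rewrite (raddf_sum (msym s)); apply: eq_bigr => l _.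
by rewrite /= msymM IH ?rmorphXn /= ?msym_xvar // -ltnS.
Qed.

Lemma pole_coef_sym s i t : msym s (pole_coef x c i t) = pole_coef x c (s i) t.
Proof.
rewrite (raddf_sum (msym s)); apply: eq_bigr => l _.
by rewrite /= msymM singular_coef_sym rmorphXn /= msym_xvar.
Qed.

Lemma xvar_homog i : x i \is homog 1.
Proof. by rewrite dhomogX; apply/eqP/mdeg1. Qed.

Lemma pole_coef_homog_aux i t : (forall m, (m <= t)%N -> c m \is homog m) ->
  pole_coef x c i t \is homog t.
Proof.
move=> H; apply: rpred_sum => l _.
have lt : (l <= t)%N by rewrite -ltnS.
have := dhomogM (H l lt) (dhomogMn (t - l) (xvar_homog i)).
by rewrite mul1n subnKC.
Qed.

Lemma singular_coef_homog t : c t \is homog t.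
Proof.
move: t; apply: (newton_ind (P := fun t p => p \is homog t)) => [|t IH]; first exact: dhomog1.
do 2 apply: rpredZ; apply: rpred_sum => j _.
exact: dhomogM (xvar_homog j) (pole_coef_homog_aux j IH).
Qed.

Lemma pole_coef_homog i t : pole_coef x c i t \is homog t.
Proof. by apply: pole_coef_homog_aux => m _; apply: singular_coef_homog. Qed.

Lemma mderiv_xvar i j : mderiv i (x j) = (i == j)%:R.
Proof.
rewrite /xvar mderivX mnm1E eq_sym; case: eqP => [->|_]; last by rewrite scale0r.
rewrite scale1r (_ : mnm_sub _ _ = @mnm0 n) ?mpolyX0 //.
by apply/mnmP => k; rewrite mnmBE subnn mnm0E.
Qed.

Lemma mderiv_pole_coef_aux i j t :
  (forall m, (m < t.+1)%N -> mderiv i (c m.+1) = - al%:A * pole_coef x c i m) ->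
  mderiv i (pole_coef x c j t.+1) =
  - al%:A * pole2_coef x c i j t + (i == j)%:R * pole2_coef x c j j t.
Proof.
elim: t => [|t IH] H.
  rewrite pole_coefS mderivD mderivM H // !pole_coef0 singular_coef0 mderiv_xvar /=.
  by rewrite -mpolyC1 mderivC mpolyC1 singular_coef0; ring.
rewrite pole_coefS mderivD H // mderivM IH; last by move=> m mt; apply/H/ltnW.
rewrite mderiv_xvar !pole2_coefS; case: eqP => [->|_]; rewrite ?mul1r ?mul0r; ring.
Qed.

(** Expected from the logarithmic derivative of P^a in x_i.  Differentiating
    the recurrence gives, by induction, t + 1 times the claim, after the
    derivatives of the other coefficients have been summed up by
    [euler_pole_coef]. *)
Lemma mderiv_singular_coef i t : mderiv i (c t.+1) = - al%:A * pole_coef x c i t.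
Proof.
elim/ltn_ind: t => t IH.
have /pcharf0P h := ch.
have e0 : t.+1%:R != 0 :> A by rewrite -mpolyC_nat mpolyC_eq0 h.
apply: (mulfI e0).
have -> : t.+1%:R * mderiv i (c t.+1) = mderiv i (t.+1%:R * c t.+1).
  by rewrite !mulr_natl mderivMn.
rewrite singular_coef_newton -scaleNr mulr_algl mderivZ (raddf_sum (mderiv i)) /=.
case: t IH {e0} => [|t] IH.
  rewrite mul1r mulr_algl. congr (_ *: _). rewrite (bigD1 i) //= big1 => [|j ji].
    by rewrite mderivM mderiv_xvar eqxx !pole_coef0 singular_coef0 -mpolyC1 mderivC
      mpolyC1 mulr0 mulr1 !addr0.
  by rewrite mderivM mderiv_xvar eq_sym (negbTE ji) !pole_coef0 singular_coef0 -mpolyC1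
    mderivC mulr0 mul0r addr0.
rewrite mulrCA mulr_algl; congr (_ *: _).
under eq_bigr => j _ do rewrite mderivM mderiv_xvar mderiv_pole_coef_aux //.
rewrite big_split /= (bigD1 i) //= eqxx mul1r big1 ?addr0; last first.
  by move=> j ji; rewrite eq_sym (negbTE ji) mul0r.
under eq_bigr do rewrite mulrDr.
have S2 : \sum_(j < n) x j * ((i == j)%:R * pole2_coef x c j j t) = x i * pole2_coef x c i i t.
  rewrite (bigD1 i) //= eqxx mul1r big1 ?addr0 // => j ji.
  by rewrite eq_sym (negbTE ji) mul0r mulr0.
rewrite big_split /= S2.
have E := euler_pole_coef singular_coef_newton i t.
rewrite -[t.+2]add1n natrD mulrDl mul1r E; congr (_ + (_ + _)).
by rewrite mulr_sumr; apply: eq_bigr => j _; ring.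
Qed.

Lemma mderiv_pole_coef i j t :
  mderiv i (pole_coef x c j t.+1) =
  - al%:A * pole2_coef x c i j t + (i == j)%:R * pole2_coef x c j j t.
Proof. by apply: mderiv_pole_coef_aux => m _; apply: mderiv_singular_coef. Qed.

End SingularCoefficients.

(** * Translations, Dunkl operators and the submodule I_k *)

Section Translation.
Context (F : fieldType) (n : nat).
Local Notation A := (mpoly n F).
Local Notation x := (@xvar F n).

(** A polynomial is built from constants and variables by sums and products, so
    identities of ring morphisms or derivations may be checked on generators. *)
Lemma mpoly_ring_ind (P : A -> Prop) :
  (forall a, P (mpolyC n a)) -> (forall i, P (x i)) ->
  (forall p q, P p -> P q -> P (p + q)) ->
  (forall p q, P p -> P q -> P (p * q)) -> forall p, P p.
Proof.
move=> PC PX PD PM; have PXm m : P (mpolyX F m).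
  rewrite mpolyXE_id; elim/big_ind: _ => // [|i _]; first by rewrite -mpolyC1.
  elim: (m i) => [|e IH]; first by rewrite expr0 -mpolyC1.
  by rewrite exprS; apply: PM => //; apply: PX.
elim/mpolyind => [|a m p _ _ IH]; first by rewrite -mpolyC0.
by apply: PD => //; rewrite -mul_mpolyC; apply: PM.
Qed.

Lemma eq_mpoly_morph (S : comNzRingType) (f g : {rmorphism A -> S}) :
  (forall a, f (mpolyC n a) = g (mpolyC n a)) -> (forall i, f (x i) = g (x i)) ->
  f =1 g.
Proof.
move=> hC hX; apply: mpoly_ring_ind => // p q hp hq.
  by rewrite !rmorphD hp hq.
by rewrite !rmorphM hp hq.
Qed.

Definition translate (q : A) : A -> A := comp_mpoly [tuple x i + q | i < n].
HB.instance Definition _ q := GRing.RMorphism.on (translate q).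

Lemma translateX q i : translate q (x i) = x i + q.
Proof. by rewrite /translate comp_mpolyXU -tnth_nth tnth_mktuple. Qed.

Lemma translateC q a : translate q (mpolyC n a) = mpolyC n a.
Proof. exact: comp_mpolyC. Qed.

Lemma translateZ q a p : translate q (a *: p) = a *: translate q p.
Proof. exact: comp_mpolyZ. Qed.

Lemma transl_invP p :
  @transl_inv F n p <-> forall a, translate (mpolyC n a) p = p.
Proof. by []. Qed.

(** The polynomial p(x_1 + t, ..., x_n + t) in a new variable t.  It relates
    invariance under translations by scalars to the vanishing of its
    derivative in t, and to invariance under translations by polynomials. *)
Definition generic_translate : A -> {poly A} :=
  mmap (polyC \o @mpolyC n F) (fun i => (x i)%:P + 'X).
HB.instance Definition _ := GRing.RMorphism.on generic_translate.

Lemma generic_translateX i : generic_translate (x i) = (x i)%:P + 'X.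
Proof. by rewrite /generic_translate mmapX mmap1U. Qed.

Lemma generic_translateC a : generic_translate (mpolyC n a) = (mpolyC n a)%:P.
Proof. by rewrite /generic_translate mmapC. Qed.

Lemma generic_translateD p q :
  generic_translate (p + q) = generic_translate p + generic_translate q.
Proof. exact: (rmorphD generic_translate). Qed.

Lemma generic_translateM p q :
  generic_translate (p * q) = generic_translate p * generic_translate q.
Proof. exact: (rmorphM generic_translate). Qed.

Lemma horner_generic_translate p q : (generic_translate p).[q] = translate q p.
Proof.
apply: (@eq_mpoly_morph _ (horner_eval q \o generic_translate) (translate q)).
  by move=> a; rewrite /= /horner_eval generic_translateC hornerC translateC.
by move=> i; rewrite /= /horner_eval generic_translateX translateX !hornerE.
Qed.


Lemma deriv_generic_translate p :
  (generic_translate p)^`() = \sum_i generic_translate (mderiv i p).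
Proof.
elim/mpoly_ring_ind: p => [a|i|p q IHp IHq|p q IHp IHq].
- rewrite generic_translateC derivC big1 // => i _.
  by rewrite mderivC (rmorph0 generic_translate).
- rewrite generic_translateX derivD derivC derivX add0r (bigD1 i) //=.
  rewrite mderiv_xvar eqxx (rmorph1 generic_translate) big1 ?addr0 // => j ji.
  by rewrite mderiv_xvar (negbTE ji) (rmorph0 generic_translate).
- transitivity (\sum_i generic_translate (mderiv i p) + \sum_i generic_translate (mderiv i q)).
    by rewrite generic_translateD derivD; congr (_ + _); [exact: IHp | exact: IHq].
  rewrite -[LHS]big_split; apply: eq_bigr => i _.
  by rewrite mderivD generic_translateD.
- transitivity ((\sum_i generic_translate (mderiv i p)) * generic_translate q +
    generic_translate p * (\sum_i generic_translate (mderiv i q))).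
    by rewrite generic_translateM derivM; congr (_ * _ + _ * _); [exact: IHp | exact: IHq].
  rewrite mulr_suml [X in _ + X]mulr_sumr -[LHS]big_split; apply: eq_bigr => i _ /=.
  by rewrite mderivM generic_translateD !generic_translateM.
Qed.

Hypothesis ch : [pchar F] =i pred0.

Lemma natr_mpoly_neq0 m : (m.+1%:R != 0 :> A).
Proof. by have /pcharf0P h := ch; rewrite -mpolyC_nat mpolyC_eq0 h. Qed.

Lemma natr_mpoly_inj : injective (fun m => m%:R : A).
Proof.
apply: natr_inj; apply/pcharf0P => -[|m]; first by rewrite mulr0n !eqxx.
by rewrite (negbTE (natr_mpoly_neq0 m)).
Qed.

Lemma transl_inv_deriv p : \sum_i mderiv i p = 0 -> @transl_inv F n p.
Proof.
move=> h; apply/transl_invP => a; rewrite -horner_generic_translate.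
have D : (generic_translate p)^`() = 0.
  by rewrite deriv_generic_translate -(rmorph_sum generic_translate) h
    (rmorph0 generic_translate).
have C : generic_translate p = ((generic_translate p)`_0)%:P.
  apply/polyP => -[|l]; rewrite coefC //=; have := congr1 (fun q : {poly A} => q`_l) D.
  rewrite coef_deriv coef0 -mulr_natl => /eqP; rewrite mulf_eq0.
  by rewrite (negbTE (natr_mpoly_neq0 l)) => /eqP.
rewrite C hornerC -horner_coef0 horner_generic_translate.
apply: (@eq_mpoly_morph _ (translate 0) idfun) => [b|i] /=.
  exact: translateC.
by rewrite translateX addr0.
Qed.

(** A polynomial in t which is constant on the infinitely many integers is
    constant; hence t may be replaced by any polynomial. *)
Lemma transl_inv_generic p q : @transl_inv F n p -> translate q p = p.
Proof.
move=> hp; rewrite -horner_generic_translate.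
set P := generic_translate p.
suff /eqP : P - p%:P = 0 by rewrite subr_eq0 => /eqP ->; rewrite hornerC.
pose s := [seq l%:R : A | l <- iota 0 (size (P - p%:P))].
apply: (@roots_geq_poly_eq0 _ _ s); last by rewrite size_map size_iota.
- apply/allP => _ /mapP[l _ ->].
  rewrite rootE hornerD hornerN hornerC horner_generic_translate -mpolyC_nat.
  by rewrite (transl_invP p).1 // subrr.
- by rewrite map_inj_uniq ?iota_uniq //; apply: natr_mpoly_inj.
Qed.

Section Closure.
Local Notation tinv := (@transl_inv F n).

Lemma transl_invD p q : tinv p -> tinv q -> tinv (p + q).
Proof. by move=> hp hq a; rewrite comp_mpolyD hp hq. Qed.

Lemma transl_invM p q : tinv p -> tinv q -> tinv (p * q).
Proof.
move=> /transl_invP hp /transl_invP hq; apply/transl_invP => a.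
by rewrite rmorphM /= hp hq.
Qed.

Lemma transl_invZ a p : tinv p -> tinv (a *: p).
Proof. by move=> hp b; rewrite comp_mpolyZ hp. Qed.

Lemma transl_invC a : tinv (mpolyC n a).
Proof. by move=> b; rewrite comp_mpolyC. Qed.

Lemma transl_inv1 : tinv 1.
Proof. by rewrite -mpolyC1; apply: transl_invC. Qed.

Lemma transl_inv0 : tinv 0.
Proof. by rewrite -mpolyC0; apply: transl_invC. Qed.

Lemma transl_invN p : tinv p -> tinv (- p).
Proof. by rewrite -scaleN1r; apply: transl_invZ. Qed.


Lemma transl_inv_sum (J : Type) (s : seq J) (P : pred J) (f : J -> A) :
  (forall j, P j -> tinv (f j)) -> tinv (\sum_(j <- s | P j) f j).
Proof.
move=> h; elim/big_ind: _ => //; first exact: transl_inv0.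
exact: transl_invD.
Qed.

Lemma transl_invX p m : tinv p -> tinv (p ^+ m).
Proof.
move=> h; elim: m => [|m IH]; first exact: transl_inv1.
by rewrite exprS; apply: transl_invM.
Qed.

Lemma transl_inv_sub i j : tinv (x i - x j).
Proof. by apply/transl_invP => a; rewrite rmorphB /= !translateX; ring. Qed.

Lemma transl_inv_linear (b : 'I_n -> F) : \sum_i b i = 0 -> tinv (\sum_i b i *: x i).
Proof.
move=> b0; apply/transl_invP => a; rewrite rmorph_sum /=.
under eq_bigr do rewrite translateZ translateX scalerDr.
by rewrite big_split /= -[X in _ + X]scaler_suml b0 scale0r addr0.
Qed.

Lemma msymC s (a : F) : msym s (mpolyC n a) = mpolyC n a.
Proof. by rewrite /msym mmapC. Qed.

Lemma translate_msym s (a : F) p :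
  translate (mpolyC n a) (msym s p) = msym s (translate (mpolyC n a) p).
Proof.
apply: (@eq_mpoly_morph _ (translate (mpolyC n a) \o msym s)
  (msym s \o translate (mpolyC n a))) => [b|i] /=.
  by rewrite msymC translateC msymC.
by rewrite translateX !msym_xvar translateX msymD msym_xvar msymC.
Qed.

Lemma transl_inv_msym s p : tinv p -> tinv (msym s p).
Proof.
by move=> /transl_invP hp; apply/transl_invP => a; rewrite translate_msym hp.
Qed.

Lemma translate_mderiv i (a : F) p :
  translate (mpolyC n a) (mderiv i p) = mderiv i (translate (mpolyC n a) p).
Proof.
elim/mpoly_ring_ind: p => [b|j|p q IHp IHq|p q IHp IHq].
- by rewrite translateC mderivC (rmorph0 (translate _)).
- by rewrite translateX mderivD mderivC addr0 mderiv_xvar (rmorph_nat (translate _)).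
- by rewrite mderivD !(rmorphD (translate _)) /= mderivD IHp IHq.
- by rewrite mderivM !(rmorphD (translate _)) !(rmorphM (translate _)) /= mderivM IHp IHq.
Qed.

Lemma transl_inv_mderiv i p : tinv p -> tinv (mderiv i p).
Proof.
by move=> /transl_invP hp; apply/transl_invP => a; rewrite translate_mderiv hp.
Qed.

Lemma xvar_inj : injective x.
Proof.
move=> i j /(congr1 (mderiv i)); rewrite !mderiv_xvar eqxx; case: eqP => // _ /eqP.
by rewrite oner_eq0.
Qed.

(** The divided difference is only given by an existence statement, so it is
    always computed from its characteristic equation. *)
Lemma divdiff_uniq (i j : 'I_n) (p q : A) : i != j ->
  (x i - x j) * q = p - msym (tperm i j) p -> divdiff i j p = q.
Proof.
move=> ij E; apply: (mulfI (x := x i - x j)); last by rewrite divdiffP E.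
by rewrite subr_eq0; apply: contra_neq ij; apply: xvar_inj.
Qed.

Lemma transl_inv_divdiff (i j : 'I_n) (p : A) : i != j -> tinv p -> tinv (divdiff i j p).
Proof.
move=> ij hp; apply/transl_invP => a; symmetry; apply: (divdiff_uniq ij).
have /transl_invP/(_ a) <- := transl_inv_sub i j.
rewrite -rmorphM /= divdiffP rmorphB /= translate_msym.
by have /transl_invP -> := hp.
Qed.

(** The twisted Leibniz rule of divided differences. *)
Lemma divdiffM (i j : 'I_n) (p q : A) : i != j ->
  divdiff i j (p * q) = divdiff i j p * msym (tperm i j) q + p * divdiff i j q.
Proof.
move=> ij; apply: (divdiff_uniq ij).
rewrite mulrDr mulrA divdiffP mulrCA divdiffP msymM; ring.
Qed.

Lemma divdiffN (i j : 'I_n) (p : A) : i != j -> divdiff i j (- p) = - divdiff i j p.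
Proof. by move=> ij; apply: (divdiff_uniq ij); rewrite mulrN divdiffP msymN; ring. Qed.

Lemma divdiffD (i j : 'I_n) (p q : A) : i != j ->
  divdiff i j (p + q) = divdiff i j p + divdiff i j q.
Proof.
move=> ij; apply: (divdiff_uniq ij); rewrite mulrDr msymD opprD addrACA.
by congr (_ + _); apply: divdiffP.
Qed.

Lemma dunklN k i (p : A) : dunkl k i (- p) = - dunkl k i p.
Proof.
have S : \sum_(j | j != i) divdiff i j (- p) = - \sum_(j | j != i) divdiff i j p.
  by rewrite -sumrN; apply: eq_bigr => j ji; apply: divdiffN; rewrite eq_sym.
by rewrite /dunkl mderivN [X in _ - _ *: X = _]S scalerN opprD.
Qed.

End Closure.
End Translation.

Section SubmoduleI.
Context (F : fieldType) (n r : nat).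
Hypotheses (ch : [pchar F] =i pred0) (r0 : (0 < r)%N) (n0 : (0 < n)%N).
Local Notation A := (mpoly n F).
Local Notation x := (@xvar F n).
Local Notation tinv := (@transl_inv F n).
Local Notation al := (r%:R / n%:R : F).
Local Notation c := (singular_coef n al).
Local Notation f := (@dunkl_singular F n r).

Lemma slope_mul : al * n%:R = r%:R.
Proof. by have /pcharf0P h := ch; rewrite divfK // h -lt0n. Qed.

Lemma divdiff_pole_coef i l t : i != l ->
  divdiff i l (pole_coef x c i t.+1) = pole2_coef x c i l t.
Proof.
move=> il; apply: (divdiff_uniq il).
by rewrite pole_coef_sym // tpermL pole_coef_diff.
Qed.

(** For j <> i, the derivative of f_j and its divided difference along x_i - x_j
    are multiples of the same double pole coefficient, and they cancel.  For
    j = i the sum of the terms is the residue of a derivative. *)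
Lemma dunkl_singular_kill i j : dunkl al i (f j) = 0.
Proof.
rewrite dunkl_singularE // dunklN; apply/eqP; rewrite oppr_eq0; apply/eqP.
have [r' Er] : exists r', r = r'.+1 by exists r.-1; rewrite prednK.
rewrite (_ : pole_coef x c j r = pole_coef x c j r'.+1) /dunkl ?mderiv_pole_coef //;
  last by rewrite -Er.
case: (eqVneq i j) => [<-|ij].
  have E : pole2_coef x c i i r' - al%:A * \sum_l pole2_coef x c i l r' = 0.
    rewrite -(residue_of_derivative (@singular_coef_newton F n ch al)).
    have -> : al%:A * n%:R = r%:R :> A.
      by rewrite mulr_algl -scaler_nat scalerA slope_mul scaler_nat.
    by rewrite Er subrr mul0r.
  have S : \sum_(l | l != i) divdiff i l (pole_coef x c i r'.+1) =
      \sum_(l | l != i) pole2_coef x c i l r'.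
    by apply: eq_bigr => l li; apply: divdiff_pole_coef; rewrite eq_sym.
  have B : \sum_l pole2_coef x c i l r' =
      pole2_coef x c i i r' + \sum_(l | l != i) pole2_coef x c i l r'.
    by rewrite (bigD1 i).
  rewrite mul1r [X in _ - _ *: X = _]S -[_ *: \sum_(l | l != i) _]mulr_algl -[RHS]E [in RHS]B.
  by ring.
rewrite mul0r addr0 (bigD1 j) 1?eq_sym //= big1 => [|l /andP[li lj]].
  rewrite addr0 (@divdiff_uniq _ _ i j _ (- pole2_coef x c i j r')) //.
    by rewrite mulNr mulr_algl scalerN opprK addNr.
  by rewrite pole_coef_sym // tpermR mulrN pole_coef_diff opprB.
have il : i != l by rewrite eq_sym.
by apply: (divdiff_uniq il); rewrite pole_coef_sym // tpermD ?subrr ?mulr0 // eq_sym.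
Qed.

Lemma divdiff_anti (i j : 'I_n) (p : A) : i != j -> divdiff j i p = - divdiff i j p.
Proof.
have ji : i != j -> j != i by rewrite eq_sym.
by move=> /ji ij; apply: (divdiff_uniq ij); rewrite tpermC mulrN -mulNr opprB divdiffP.
Qed.

(** The divided differences are antisymmetric in their two indices, so they
    cancel in the sum. *)
Lemma sum_dunkl k (p : A) : \sum_i dunkl k i p = \sum_i mderiv i p.
Proof.
rewrite sumrB -scaler_sumr -[RHS]subr0; congr (_ - _).
suff /eqP : \sum_i \sum_(j | j != i) divdiff i j p = - \sum_i \sum_(j | j != i) divdiff i j p.
  rewrite -addr_eq0 -mulr2n -mulr_natl mulf_eq0 (negbTE (natr_mpoly_neq0 _ ch 1)) /=.
  by move=> /eqP ->; rewrite scaler0.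
rewrite [LHS](exchange_big_dep predT) //= -sumrN; apply: eq_bigr => j _.
rewrite -sumrN; apply: eq_big => [i|i ij]; first by rewrite eq_sym.
by rewrite divdiff_anti // eq_sym.
Qed.

(** Since the Dunkl operators kill f_j, so does their sum, which is the
    derivative along the translations. *)
Lemma transl_inv_singular j : tinv (f j).
Proof.
apply: transl_inv_deriv => //; rewrite -(sum_dunkl al) big1 // => i _.
exact: dunkl_singular_kill.
Qed.

Lemma msym_singular s i : msym s (f i) = f (s i).
Proof. by rewrite !dunkl_singularE // msymN pole_coef_sym. Qed.

Definition ideal_I : set A :=
  [set p | exists2 g : 'I_n -> A, (forall i, tinv (g i)) & p = \sum_i g i * f i].

Lemma ideal_I0 : ideal_I 0.
Proof.
by exists (fun=> 0) => [i|]; [exact: transl_inv0 | rewrite big1 // => i _; rewrite mul0r].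
Qed.

Lemma ideal_ID p q : ideal_I p -> ideal_I q -> ideal_I (p + q).
Proof.
move=> [g hg ->] [h hh ->]; exists (fun i => g i + h i) => [i|]; first exact: transl_invD.
by rewrite -big_split; apply: eq_bigr => i _; rewrite mulrDl.
Qed.

Lemma ideal_IM p q : tinv p -> ideal_I q -> ideal_I (p * q).
Proof.
move=> hp [h hh ->]; exists (fun i => p * h i) => [i|]; first exact: transl_invM.
by rewrite mulr_sumr; apply: eq_bigr => i _; rewrite mulrA.
Qed.

Lemma ideal_I_sum (J : Type) (s : seq J) (P : pred J) (g : J -> A) :
  (forall j, P j -> ideal_I (g j)) -> ideal_I (\sum_(j <- s | P j) g j).
Proof. by move=> h; elim/big_ind: _ => //; [exact: ideal_I0 | exact: ideal_ID]. Qed.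

Lemma ideal_IZ a p : ideal_I p -> ideal_I (a *: p).
Proof. by rewrite -mul_mpolyC; apply/ideal_IM/transl_invC. Qed.

Lemma ideal_I_singular i : ideal_I (f i).
Proof.
exists (fun j => (j == i)%:R) => [j|].
  by case: (_ == _); [exact: transl_inv1 | exact: transl_inv0].
rewrite (bigD1 i) //= eqxx mul1r big1 ?addr0 // => j /negbTE ->.
by rewrite mul0r.
Qed.

Lemma dunkl_sum k i (J : Type) (s : seq J) (g : J -> A) :
  dunkl k i (\sum_(j <- s) g j) = \sum_(j <- s) dunkl k i (g j).
Proof.
elim: s => [|j s IH].
  rewrite !big_nil; have := dunklN k i (0 : A); rewrite oppr0 => /eqP.
  rewrite -addr_eq0 -mulr2n -mulr_natl mulf_eq0 (negbTE (natr_mpoly_neq0 _ ch 1)) /=.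
  by move=> /eqP.
set q := \sum_(j <- s) g j.
have S : \sum_(l | l != i) divdiff i l (g j + q) =
    \sum_(l | l != i) divdiff i l (g j) + \sum_(l | l != i) divdiff i l q.
  rewrite -big_split; apply: eq_bigr => l li; apply: divdiffD; by rewrite eq_sym.
rewrite !big_cons -IH -/q /dunkl mderivD [X in _ - _ *: X = _]S scalerDr opprD.
by rewrite addrACA.
Qed.

(** The Leibniz rule, in which the Dunkl operator does not reach the singular
    factor f_j: the result is again a combination of singular polynomials. *)
Lemma dunkl_mul_singular i j g :
  dunkl al i (g * f j) = mderiv i g * f j -
    al *: \sum_(l | l != i) divdiff i l g * f (tperm i l j).
Proof.
transitivity (mderiv i g * f j - al *: (\sum_(l | l != i) divdiff i l g * f (tperm i l j))
  + g * dunkl al i (f j)); last by rewrite dunkl_singular_kill mulr0 addr0.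
have S : \sum_(l | l != i) divdiff i l (g * f j) =
    \sum_(l | l != i) divdiff i l g * f (tperm i l j) +
    g * \sum_(l | l != i) divdiff i l (f j).
  rewrite mulr_sumr -big_split; apply: eq_bigr => l li /=.
  by rewrite divdiffM ?msym_singular // eq_sym.
rewrite /dunkl mderivM [X in _ - _ *: X = _]S scalerDr mulrBr -[g * (_ *: _)]scalerAr opprD.
by rewrite addrACA.
Qed.

Lemma cherednik_ideal_I : cherednik_submodule al ideal_I.
Proof.
split.
- move=> _ [g hg ->]; apply: transl_inv_sum => i _; apply: transl_invM => //.
  exact: transl_inv_singular.
- exact: ideal_I0.
- exact: ideal_ID.
- exact: ideal_IZ.
- move=> s _ [g hg ->]; rewrite (raddf_sum (msym s)); apply: ideal_I_sum => i _.
  rewrite /= msymM msym_singular; apply: ideal_IM; last exact: ideal_I_singular.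
  exact: transl_inv_msym.
- by move=> b p b0 Ip; apply: ideal_IM => //; apply: transl_inv_linear.
- move=> y _ [g hg ->]; apply: ideal_I_sum => i _; apply: ideal_IZ.
  rewrite dunkl_sum; apply: ideal_I_sum => j _; rewrite dunkl_mul_singular.
  apply: ideal_ID.
    by apply/ideal_IM; [exact: transl_inv_mderiv | exact: ideal_I_singular].
  rewrite -scaleNr; apply/ideal_IZ/ideal_I_sum => l li.
  apply/ideal_IM; last exact: ideal_I_singular.
  by apply: transl_inv_divdiff; rewrite 1?eq_sym.
Qed.

Definition mean : A := n%:R^-1 *: \sum_i x i.

(** The substitution of x_i minus the mean of the variables for x_i, a
    retraction of the polynomial ring onto its translation-invariant
    subring. *)
Definition center : A -> A := translate (- mean).
HB.instance Definition _ := GRing.RMorphism.on center.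

Lemma center_id p : tinv p -> center p = p.
Proof. exact: transl_inv_generic. Qed.

Lemma centerX i : center (x i) = x i - mean.
Proof. exact: translateX. Qed.

Lemma mean_linear i : exists2 b : 'I_n -> F, \sum_j b j = 0 &
  x i - mean = \sum_j b j *: x j.
Proof.
exists (fun j => (j == i)%:R - n%:R^-1).
  rewrite sumrB sumr_const card_ord -[_ *+ n]mulr_natl divff; last first.
    by have /pcharf0P -> := ch; rewrite -lt0n.
  rewrite (bigD1 i) //= eqxx big1 ?addr0 ?subrr // => j /negbTE ->.
  by [].
under eq_bigr do rewrite scalerBl.
rewrite sumrB -scaler_sumr (bigD1 i) //= eqxx scale1r big1 ?addr0 //.
by move=> j /negbTE ->; rewrite scale0r.
Qed.

Lemma transl_inv_centerX i : tinv (x i - mean).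
Proof. by have [b b0 ->] := mean_linear i; apply: transl_inv_linear. Qed.

Lemma transl_inv_center p : tinv (center p).
Proof.
elim/mpoly_ring_ind: p => [a|i|p q IHp IHq|p q IHp IHq].
- by rewrite /center translateC; apply: transl_invC.
- by rewrite centerX; apply: transl_inv_centerX.
- by rewrite (rmorphD center); apply: transl_invD.
- by rewrite (rmorphM center); apply: transl_invM.
Qed.

(** Multiplications by translation-invariant linear forms generate those by all
    translation-invariant polynomials, since the latter are polynomials in
    the centred variables. *)
Lemma submoduleM (N : set A) p q : cherednik_submodule al N -> tinv p -> N q -> N (p * q).
Proof.
move=> hN hp; rewrite -(center_id hp);
  elim/mpoly_ring_ind: p {hp} q => [a|i|p q IHp IHq|p q IHp IHq] s hs.
- by rewrite /center translateC mul_mpolyC; apply: submodZ hN _ _ _.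
- rewrite centerX; have [b b0 ->] := mean_linear i.
  exact: submod_hdual hN _ _ _ _.
- by rewrite (rmorphD center) mulrDl; apply: submodD hN _ _ _ _; [exact: IHp | exact: IHq].
- by rewrite (rmorphM center) -mulrA; apply/IHp/IHq.
Qed.

Lemma submodule_IE : @submodule_I F n r = ideal_I.
Proof.
apply/seteqP; split.
  apply: smallest_sub; first exact: cherednik_ideal_I.
  by move=> _ [i _ <-]; apply: ideal_I_singular.
move=> _ [g hg ->] N [hN hf]; elim/big_ind: _ => [|p q|i _].
- exact: submod0 hN.
- exact: submodD hN p q.
- by apply: submoduleM => //; apply: hf; exists i.
Qed.

End SubmoduleI.

(** * The support *)

Section Morphism.
Context (F : fieldType) (n r : nat) (K : idomainType) (phi : {rmorphism mpoly n F -> K}).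
Hypotheses (ch : [pchar F] =i pred0) (r0 : (0 < r)%N) (n0 : (0 < n)%N).
Local Notation A := (mpoly n F).
Local Notation x := (@xvar F n).
Local Notation al := (r%:R / n%:R : F).
Local Notation c := (singular_coef n al).

Lemma pchar_morph : [pchar K] =i pred0.
Proof.
have /pcharf0P h := ch.
apply/pcharf0P => -[|m]; first by rewrite mulr0n !eqxx.
apply/negbTE/eqP => E; have : phi (m.+1%:R * (m.+1%:R^-1)%:A) = 1.
  by rewrite mulr_natl -scaler_nat scalerA divff ?h // scale1r rmorph1.
by rewrite rmorphM /= rmorph_nat E mul0r => /eqP; rewrite eq_sym oner_eq0.
Qed.

Lemma pole_coef_morph i t : phi (pole_coef x c i t) = pole_coef (phi \o x) (phi \o c) i t.
Proof.
by rewrite /pole_coef rmorph_sum; apply: eq_bigr => l _; rewrite /= rmorphM rmorphXn.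
Qed.

Lemma newton_recurrence_morph : newton_recurrence (phi \o x) (phi \o c) (phi al%:A).
Proof.
move=> t; have := congr1 phi (@singular_coef_newton F n ch al t).
rewrite !rmorphM rmorph_nat rmorphN rmorph_sum /= => ->; congr (_ * _).
by apply: eq_bigr => j _; rewrite rmorphM pole_coef_morph.
Qed.

(** The criterion for the common zeros of the f_i, for points with
    coordinates in an arbitrary integral domain over the base field. *)
Lemma singular_roots_multiplicityP :
  (forall i, phi (dunkl_singular F r i) = 0) <->
  (forall y, exists e, (n * e = r * count_mem y (codom (phi \o x)))%N).
Proof.
have na : n%:R * phi al%:A = r%:R :> K.
  rewrite -(rmorph_nat phi) -rmorphM -[in RHS](rmorph_nat phi); congr (phi _).
  by rewrite mulrC mulr_algl -scaler_nat scalerA slope_mul // scaler_nat.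
have c0 : (phi \o c) 0 = 1 by rewrite /= singular_coef0 rmorph1.
have E i : (phi (dunkl_singular F r i) = 0) <-> (pole_coef (phi \o x) (phi \o c) i r = 0).
  rewrite dunkl_singularE // rmorphN pole_coef_morph.
  by split=> [/eqP|->]; rewrite ?oppr0 // oppr_eq0 => /eqP.
split=> H; last by move=> i; apply/E;
  apply: (multiplicity_roots r0 pchar_morph na c0 newton_recurrence_morph).
by apply: (roots_multiplicity r0 pchar_morph na c0 newton_recurrence_morph) => i; apply/E.
Qed.

End Morphism.

Section Blocks.

(** By Gauss, since n / d and r / d are coprime. *)
Lemma multiple_count n r k : (0 < n)%N ->
  (exists e, n * e = r * k)%N <-> (n %/ gcdn r n %| k)%N.
Proof.
move=> n0; have g0 : (0 < gcdn r n)%N by rewrite gcdn_gt0 n0 orbT.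
have cop : coprime (n %/ gcdn r n) (r %/ gcdn r n).
  rewrite /coprime -(eqn_pmul2r g0) mul1n muln_gcdl.
  by rewrite !divnK ?dvdn_gcdl ?dvdn_gcdr // gcdnC.
rewrite -(Gauss_dvdr _ cop) -(dvdn_pmul2l g0) !mulnA ![(gcdn r n * _)%N]mulnC.
rewrite !divnK ?dvdn_gcdl ?dvdn_gcdr //.
by split=> [[e <-]|/dvdnP[e ->]]; [rewrite dvdn_mulr | exists e; rewrite mulnC].
Qed.

(** The occurrences of one value, whose number is a multiple of b, are placed in
    front, where they fill whole blocks. *)
Lemma block_arrangement (T : eqType) (b : nat) (s : seq T) : (0 < b)%N ->
  (forall y, (b %| count_mem y s)%N) ->
  exists2 s', perm_eq s' s & forall x0 i j, (i < size s)%N -> (j < size s)%N ->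
    (i %/ b = j %/ b)%N -> nth x0 s' i = nth x0 s' j.
Proof.
move=> b0; have [N] := ubnP (size s); elim: N s => // N IH s sN hs.
case: s sN hs => [|y s0] sN hs; first by exists [::].
set s := y :: s0 in sN hs *; pose s1 := [seq z <- s | z != y].
have cy : (0 < count_mem y s)%N by rewrite /= eqxx.
have ps : perm_eq (nseq (count_mem y s) y ++ s1) s.
  have E : [seq z <- s | pred1 y z] = nseq (count_mem y s) y.
    by rewrite -size_filter; apply/all_pred1P/filter_all.
  by rewrite -E; apply: permEl; apply: (perm_filterC (pred1 y)).
have ss : (count_mem y s + size s1 = size s)%N.
  by rewrite -(perm_size ps) size_cat size_nseq.
have [||s1' ps1 hs1] := IH s1.
- by rewrite -ltnS; apply: leq_trans sN; rewrite ltnS -ss; lia.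
- move=> z; rewrite count_filter; have := hs z.
  case: (eqVneq z y) => [-> _|zy].
    by rewrite (eq_count (a2 := pred0)) ?count_pred0 // => w /=; case: eqP.
  by rewrite (@eq_count _ (predI _ _) (pred1 z)) // => w /=; case: eqP => // ->.
exists (nseq (count_mem y s) y ++ s1').
  by apply: perm_trans ps; rewrite perm_cat2l.
move=> x0 i j si sj ij; rewrite !nth_cat size_nseq.
have /dvdnP [q Eq] := hs y.
have side k : (k < count_mem y s)%N = (k %/ b < q)%N by rewrite Eq ltn_divLR.
rewrite !side -ij -side; case: ltnP => ik.
  by rewrite !nth_nseq ik [(j < _)%N]side -ij -side ik.
have jk : (count_mem y s <= j)%N by rewrite leqNgt side -ij -side -leqNgt.
apply: hs1; [by rewrite ltn_subLR // ss | by rewrite ltn_subLR // ss |].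
by rewrite Eq !divnBMl ij.
Qed.

Lemma block_count n b (T : eqType) (w : 'I_n -> T) y :
  (b %| n)%N -> (forall i j : 'I_n, (i %/ b = j %/ b)%N -> w i = w j) ->
  (b %| count_mem y (codom w))%N.
Proof.
case: n w => [|n] w bn hw.
  have : size (codom w) = 0 by rewrite size_codom card_ord.
  by move/size0nil => ->; rewrite dvdn0.
case/dvdnP: bn => q Eq; have b0 : (0 < b)%N by case: (b) Eq => //; rewrite muln0.
have -> : count_mem y (codom w) = (\sum_(i < n.+1) (w (inord (i %/ b * b)) == y))%N.
  rewrite -sum1_count big_image_cond /= big_mkcond; apply: eq_bigr => i _.
  rewrite -[RHS]/(nat_of_bool _); rewrite (_ : w (inord _) = w i); first by case: (_ == _).
  by rewrite (hw i (inord (i %/ b * b))) // inordK ?mulnK // ltnS -ltnS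
    (leq_ltn_trans (leq_divM _ _)).
rewrite -(big_mkord predT (fun i => (w (inord (i %/ b * b)) == y) : nat)) /= Eq.
elim: q {Eq} => [|q IH]; first by rewrite mul0n big_geq ?dvdn0.
rewrite mulSn addnC (big_cat_nat (n := q * b)) ?leq_addr //= dvdn_add //.
rewrite (eq_big_nat _ _ (F2 := fun=> (w (inord (q * b)) == y) : nat)) => [|i /andP[qi ib]].
  by rewrite sum_nat_const_nat addKn dvdn_mulr.
rewrite (_ : (i %/ b = q)%N) //.
by rewrite -(subnK qi) addnC divnMDl // divn_small ?addn0 // ltn_subLR.
Qed.

(** The families all of whose values have a multiplicity divisible by b are,
    up to a permutation, those that are constant on blocks of length b. *)
Lemma block_permP n b (T : eqType) (w : 'I_n -> T) : (0 < b)%N -> (b %| n)%N ->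
  (forall y, (b %| count_mem y (codom w))%N) <->
  exists s : 'S_n, forall i j : 'I_n, (i %/ b = j %/ b)%N -> w (s i) = w (s j).
Proof.
move=> b0 bn; split=> [H|[s hs] y]; last first.
  have /seq.permP <- : perm_eq (codom (w \o s)) [tuple w i | i < n].
    by apply/tuple_permP; exists s; apply: eq_map => i; rewrite tnth_mktuple.
  exact: block_count.
have [s' ps hs] := block_arrangement b0 H.
have sz : size s' == n by rewrite (perm_size ps) size_codom card_ord.
have : perm_eq (Tuple sz) [tuple w i | i < n] by [].
move=> /tuple_permP [p Ep].
have Ew (i : 'I_n) : w (p i) = nth (w i) s' i.
  by rewrite -[s']/(tval (Tuple sz)) Ep -tnth_nth !tnth_mktuple.
exists p => i j ij; rewrite !Ew (set_nth_default (w i)) ?(eqP sz) //.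
apply: hs => //; by rewrite size_codom card_ord.
Qed.

End Blocks.

Section Support.
Context (F : fieldType) (n r : nat).
Hypotheses (ch : [pchar F] =i pred0) (r0 : (0 < r)%N) (n0 : (0 < n)%N).
Local Notation A := (mpoly n F).
Local Notation f := (@dunkl_singular F n r).
Local Notation b := (n %/ gcdn r n)%N.

Lemma block_size_gt0 : (0 < b)%N.
Proof.
have g0 : (0 < gcdn r n)%N by rewrite gcdn_gt0 n0 orbT.
by rewrite divn_gt0 //; apply: dvdn_leq => //; apply: dvdn_gcdr.
Qed.

Lemma block_size_dvd : (b %| n)%N.
Proof. by apply/dvdnP; exists (gcdn r n); rewrite mulnC divnK //; apply: dvdn_gcdr. Qed.

Lemma zero_blocksP (w : 'I_n -> F) :
  (forall i, meval w (f i) = 0) <->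
  exists s : 'S_n, forall i j : 'I_n, (i %/ b = j %/ b)%N -> w (s i) = w (s j).
Proof.
rewrite -(block_permP w block_size_gt0 block_size_dvd).
apply: iff_trans (singular_roots_multiplicityP (meval w) ch r0 n0) _.
have -> : codom (meval w \o @xvar F n) = codom w.
  by apply: eq_map => i /=; rewrite mevalXU.
by split=> H y; apply/(multiple_count _ _ n0).
Qed.

Lemma diag_equivP (y z : 'rV[F]_n) : diag_equiv y z ->
  exists a, forall i, y 0 i = a + z 0 i.
Proof.
move=> /sub_rVP [a E]; exists a => i; move/rowP/(_ i): E; rewrite !mxE mulr1 => <-.
by rewrite subrK.
Qed.

Lemma repr_pi (y : 'rV[F]_n) : diag_equiv (repr (\pi_(hspace F n) y)) y.
Proof. by rewrite -(pi_eq_quot (s := hspace F n)) reprK. Qed.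

Lemma pi_hspace_eq (y z : 'rV[F]_n) a : (forall i, y 0 i = a + z 0 i) ->
  \pi_(hspace F n) y = \pi_(hspace F n) z.
Proof.
move=> E; apply/eqP; rewrite piE; apply/sub_rVP; exists a.
by apply/rowP => i; rewrite !mxE E mulr1 addrK.
Qed.

Lemma block_union_zero (u : hspace F n) :
  (\bigcup_(s in [set: 'S_n]) (act_hspace s @` @block_subspace F n (gcdn r n))) u <->
  forall i, evalh (f i) u = 0.
Proof.
rewrite /evalh zero_blocksP; split.
  move=> [s _ [_ [y hy <-] <-]]; exists s^-1%g => i j ij.
  have [a Ea] := diag_equivP (repr_pi (col_perm s (repr (\pi_(hspace F n) y)))).
  have [a' Ea'] := diag_equivP (repr_pi y).
  by rewrite !Ea !mxE !Ea' !permKV (hy i j ij).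
move=> [s hs]; exists s^-1%g => //; exists (\pi_(hspace F n) (col_perm s (repr u))).
  by exists (col_perm s (repr u)) => // i j ij; rewrite !mxE; apply: hs.
have [a Ea] := diag_equivP (repr_pi (col_perm s (repr u))).
rewrite -[RHS]reprK; apply: (@pi_hspace_eq _ _ a) => i.
by rewrite !mxE Ea !mxE permKV.
Qed.

Lemma ideal_I_eval0 g (u : hspace F n) : (forall i, evalh (f i) u = 0) ->
  ideal_I r g -> evalh g u = 0.
Proof.
move=> h [q hq ->]; rewrite /evalh raddf_sum big1 // => i _.
by rewrite /= mevalM [X in _ * X]h mulr0.
Qed.

(** Where some f_i does not vanish, f_i kills every class; where they all
    vanish, all elements of the ideal vanish, so that the class of 1
    survives. *)
Lemma quot_supportE :
  quot_support (@transl_inv F n) (@submodule_I F n r) =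
  \bigcup_(s in [set: 'S_n]) (act_hspace s @` @block_subspace F n (gcdn r n)).
Proof.
rewrite submodule_IE //; apply/seteqP; split=> u.
  move=> [v hv H]; apply/block_union_zero => i; apply/eqP/negPn/negP => fi.
  apply: (H (f i)) => //; first exact: transl_inv_singular.
  by rewrite mulrC; apply: ideal_IM => //; apply: ideal_I_singular.
move=> /block_union_zero hu; exists 1; first exact: transl_inv1.
move=> g hg gu; rewrite mulr1 => Ig; move: gu.
by rewrite ideal_I_eval0 ?eqxx.
Qed.

End Support.

(** * Nilpotency from prime ideals *)

Section ClassicalDomain.
Variable Q : comNzRingType.

(** An alias of a commutative ring without zero divisors.  The proof is a
    parameter, so that the type carries the structure of an integral domain,
    with units and inverses chosen classically. *)
Definition classical_domain (H : forall a b : Q, a * b = 0 -> (a == 0) || (b == 0)) :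
  Type := Q.

Variable H : forall a b : Q, a * b = 0 -> (a == 0) || (b == 0).
Local Notation K := (classical_domain H).
HB.instance Definition _ := GRing.ComNzRing.on K.

Definition classical_unit : pred K := fun a => `[< exists b : K, b * a = 1 >].

Definition classical_inv (a : K) : K :=
  if pselect (exists b : K, b * a = 1) is left e then projT1 (cid e) else a.

Lemma classical_mulVr : {in classical_unit, left_inverse 1 classical_inv *%R}.
Proof.
by move=> a /asboolP h; rewrite /classical_inv; case: pselect => // e; case: cid.
Qed.

Lemma classical_unitPl : forall a b : K, b * a = 1 -> classical_unit a.
Proof. by move=> a b ba; apply/asboolP; exists b. Qed.

Lemma classical_inv_out : {in [predC classical_unit], classical_inv =1 id}.
Proof.
by move=> a /asboolP h; rewrite /classical_inv; case: pselect.
Qed.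

HB.instance Definition _ := GRing.ComNzRing_hasMulInverse.Build K
  classical_mulVr classical_unitPl classical_inv_out.
HB.instance Definition _ := GRing.ComUnitRing_isIntegral.Build K H.
End ClassicalDomain.

Section PrimeAvoidance.
Context (A : comNzRingType).

Record ideal (I : set A) : Prop := Ideal {
  ideal0 : I 0;
  idealD : forall a b, I a -> I b -> I (a + b);
  idealM : forall a b, I b -> I (a * b) }.

Section Quotient.
Variable I : set A.
Hypothesis idI : ideal I.
Hypothesis I1 : ~ I 1.
Hypothesis primeI : forall a b, I (a * b) -> I a \/ I b.

Definition ideal_pred of ideal I & ~ I 1 & (forall a b, I (a * b) -> I a \/ I b) : {pred A} :=
  fun a => `[< I a >].
Local Notation P := (ideal_pred idI I1 primeI).

Lemma ideal_pred_zmod : zmod_closed P.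
Proof.
split; first exact/asboolP/(ideal0 idI).
move=> a b /asboolP ha /asboolP hb; apply/asboolP.
by apply: (idealD idI ha); rewrite -mulN1r; apply: (idealM idI).
Qed.

Lemma ideal_pred_proper :
  1 \notin P /\ forall a, {in P, forall u, a * u \in P}.
Proof.
split; first exact/asboolP.
by move=> a b /asboolP hb; apply/asboolP/(idealM idI).
Qed.

Lemma ideal_pred_prime : prime_idealr_closed P.
Proof.
by move=> a b /asboolP/primeI[] h; apply/orP; [left | right]; apply/asboolP.
Qed.

HB.instance Definition _ := GRing.isZmodClosed.Build A P ideal_pred_zmod.
HB.instance Definition _ := isProperIdeal.Build A P ideal_pred_proper.
HB.instance Definition _ := isPrimeIdealrClosed.Build A P ideal_pred_prime.

Definition prime_pred : prime_idealr A := P.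

(** Stated with a morphism to a domain, so that the quotient by the prime ideal
    need not be mentioned again. *)
Lemma prime_quotient : exists (K : idomainType) (phi : {rmorphism A -> K}),
  forall a, phi a = 0 <-> I a.
Proof.
pose Q := Quotient.quot prime_pred.
pose H : forall a b : Q, a * b = 0 -> (a == 0) || (b == 0) :=
  @Quotient.rquot_IdomainAxiom A prime_pred.
exists (classical_domain H), (\pi_Q : {rmorphism A -> Q}).
move=> a; suff E : (\pi_Q a == 0) = `[< I a >].
  split=> [h|h]; first by apply/asboolP; rewrite -E h eqxx.
  by apply/eqP; rewrite E; apply/asboolP.
by rewrite -(rmorph0 (\pi_Q : {rmorphism A -> Q})) -Quotient.idealrBE subr0.
Qed.
End Quotient.


(** An element in all prime ideals containing J is nilpotent modulo J:
    otherwise, by Zorn's lemma, some ideal containing J is maximal among those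
    that contain no power of z, and such an ideal is prime. *)
Lemma nilpotent_mod_ideal (J : set A) (z : A) : ideal J ->
  (forall (K : idomainType) (phi : {rmorphism A -> K}),
     (forall a, J a -> phi a = 0) -> phi z = 0) ->
  exists N, J (z ^+ N).
Proof.
move=> iJ H; apply: contrapT => /forallNP zJ.
pose avoids (X : set A) := ideal X /\ forall N, ~ X (z ^+ N).
have [X [[iX zX] Xmax]] : exists X, avoids (J `|` X) /\ forall B,
    X `<` B -> ~ avoids (J `|` B).
  (* with J in each set, even the empty chain has an upper bound *)
  apply: (@Zorn_bigcup A (fun X => avoids (J `|` X))) => C hC totC.
  have [[X0 CX0]|nC] := pselect (exists X, C X); last first.
    have -> : \bigcup_(X in C) X = set0.
      by apply/seteqP; split=> // a [X CX _]; apply: nC; exists X.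
    by rewrite setU0; split=> // N JN; apply: zJ; exists N.
  have inC a : (J `|` \bigcup_(X in C) X) a -> exists2 X, C X & (J `|` X) a.
    by case=> [Ja|[X CX Xa]]; [exists X0 => //; left | exists X => //; right].
  have subC X a : C X -> (J `|` X) a -> (J `|` \bigcup_(X in C) X) a.
    by move=> CX [Ja|Xa]; [left | right; exists X].
  split; last by move=> N /inC [X CX]; apply: (hC X CX).2.
  split; first by left; apply: ideal0.
    move=> a b /inC [X CX Xa] /inC [Y CY Yb].
    have [XY|YX] := totC X Y CX CY.
      apply: (subC Y) => //; apply: (idealD (hC Y CY).1) => //.
      by case: Xa => [Ja|/XY Ya]; [left | right].
    apply: (subC X) => //; apply: (idealD (hC X CX).1) => //.
    by case: Yb => [Jb|/YX Xb]; [left | right].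
  move=> a b /inC [X CX Xb]; apply: (subC X) => //.
  exact: (idealM (hC X CX).1).
set I := J `|` X in iX zX.
have I1 : ~ I 1 by have := zX 0; rewrite expr0.
have extend a : ~ I a -> exists N b, I (z ^+ N - b * a).
  move=> Ia; pose B : set A := [set c | exists b, I (c - b * a)].
  have JB : J `|` B = B.
    apply/seteqP; split=> c; last by right.
    by case=> // Jc; exists 0; rewrite mul0r subr0; left.
  have XB : X `<` B.
    split; first by move=> c Xc; exists 0; rewrite mul0r subr0; right.
    move=> h; apply: Ia; right; apply: h; exists 1.
    by rewrite mul1r subrr; apply: (ideal0 iX).
  have := Xmax B XB; rewrite JB => nB.
  apply: contrapT => /forallNP nN; apply: nB; split; last first.
    by move=> N [b hb]; apply: (nN N); exists b.
  split.
  - by exists 0; rewrite mul0r subrr; apply: (ideal0 iX).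
  - move=> c c' [b hb] [b' hb']; exists (b + b').
    by rewrite mulrDl opprD addrACA; apply: (idealD iX).
  - move=> c c' [b hb]; exists (c * b).
    by rewrite -mulrA -mulrBr; apply: (idealM iX).
have primeI a b : I (a * b) -> I a \/ I b.
  move=> Iab; apply: contrapT => /not_orP[Ia Ib].
  have [N [a' ha]] := extend a Ia; have [M [b' hb]] := extend b Ib.
  apply: (zX (N + M)); rewrite exprD.
  have -> : z ^+ N * z ^+ M = z ^+ M * (z ^+ N - a' * a) +
     (a' * a * (z ^+ M - b' * b) + (a' * b') * (a * b)) by ring.
  by do !apply: (idealD iX); apply: (idealM iX).
have [K [phi hphi]] := prime_quotient iX I1 primeI.
apply: (zX 1); rewrite expr1; apply/hphi; apply: H => a Ja.
by apply/hphi; left.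
Qed.
End PrimeAvoidance.

(** * Nilpotency of the coordinates modulo power sums *)

(** If w_i <> 0, let g be the product of z and of the z - y over the other
    values y of w.  It has no constant term and its degree is the number of
    distinct values, so sum_j g(w_j) is a combination of the power sums and
    vanishes; but only the indices j with w_j = w_i contribute, each by
    g(w_i) <> 0. *)
Lemma power_sums_zero (K : idomainType) n (w : 'I_n -> K) : [pchar K] =i pred0 ->
  (forall l, (l < size (undup (codom w)))%N -> \sum_j w j ^+ l.+1 = 0) ->
  forall i, w i = 0.
Proof.
move=> /pcharf0P chK H i; set S := undup (codom w) in H.
have iS : w i \in S by rewrite mem_undup codom_f.
pose g0 : {poly K} := \prod_(y <- rem (w i) S) ('X - y%:P).
pose g := g0 * 'X.
have sg : (size g = (size S).+1)%N.
  rewrite size_mulX ?monic_neq0 ?monic_prod_XsubC // size_prod_XsubC size_rem //.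
  by rewrite prednK //; case: (S) iS.
have E0 : \sum_j g.[w j] = 0.
  under eq_bigr do rewrite horner_coef sg.
  rewrite exchange_big big1 // => l _; rewrite -mulr_sumr.
  case: l => -[|l] /= lS; first by rewrite coefMX mul0r.
  by rewrite H ?mulr0.
have g0w : g0.[w i] != 0.
  rewrite horner_prod prodf_seq_neq0; apply/allP => y yS; apply/implyP => _.
  rewrite hornerXsubC subr_eq0; apply/eqP => wy.
  by move: yS; rewrite mem_rem_uniq ?undup_uniq // inE wy eqxx.
have E1 : \sum_j g.[w j] = (\sum_(j | w j == w i) 1) * g.[w i].
  rewrite (bigID (fun j => w j == w i)) /= [X in _ + X]big1 ?addr0.
    by rewrite mulr_suml; apply: eq_bigr => j /eqP ->; rewrite mul1r.
  move=> j ji; rewrite hornerM; suff /rootP -> : root g0 (w j) by rewrite mul0r.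
  rewrite root_prod_XsubC mem_rem_uniq ?undup_uniq // inE ji.
  by rewrite mem_undup codom_f.
move/eqP: E0; rewrite E1 sumr_const mulf_eq0 chK -leqn0 leqNgt.
rewrite (_ : (0 < _)%N = true) /=; last first.
  by apply/card_gt0P; exists i; apply: eqxx.
by rewrite hornerM hornerX mulf_eq0 (negbTE g0w) /= => /eqP.
Qed.

(** Each distinct value occurs at least b times. *)
Lemma size_undup_blocks (T : eqType) (s : seq T) b :
  (forall y, (b %| count_mem y s)%N) -> (size (undup s) * b <= size s)%N.
Proof.
move=> H; rewrite -[in leqRHS](perm_size (perm_count_undup s)).
rewrite size_flatten sumnE /shape !big_map -sum1_size big_distrl /=.
rewrite big_seq [leqRHS]big_seq; apply: leq_sum => y ys.
by rewrite mul1n size_nseq dvdn_leq // -has_count has_pred1 -mem_undup.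
Qed.

Section Nilpotency.
Context (F : fieldType) (n r : nat).
Hypotheses (ch : [pchar F] =i pred0) (r0 : (0 < r)%N) (n0 : (0 < n)%N).
Local Notation A := (mpoly n F).
Local Notation x := (@xvar F n).
Local Notation f := (@dunkl_singular F n r).
Local Notation d := (gcdn r n).
Local Notation homog t := (@ishomog1 n F t (@mdeg n)).
Local Notation hcomp t := (@pihomog n F (@mdeg n) t).

Definition power_sum l : A := \sum_j x j ^+ l.

(** The ideal generated by the f_j and the first d power sums, in the ring of
    all polynomials in the x_i. *)
Definition extended_ideal : set A := [set p | exists (g : 'I_n -> A) (h : 'I_d -> A),
  p = \sum_j g j * f j + \sum_l h l * power_sum l.+1].

Lemma ideal_extended : ideal extended_ideal.
Proof.
split.
- exists (fun=> 0), (fun=> 0); rewrite !big1 ?addr0 // => i _; exact: mul0r.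
- move=> _ _ [g [h ->]] [g' [h' ->]].
  exists (fun j => g j + g' j), (fun l => h l + h' l).
  rewrite addrACA -!big_split /=; congr (_ + _); apply: eq_bigr => i _;
    by rewrite mulrDl.
- move=> a _ [g [h ->]]; exists (fun j => a * g j), (fun l => a * h l).
  by rewrite mulrDr !mulr_sumr; congr (_ + _); apply: eq_bigr => i _; rewrite mulrA.
Qed.

Lemma extended_singular i : extended_ideal (f i).
Proof.
exists (fun j => (j == i)%:R), (fun=> 0).
rewrite (bigD1 i) //= eqxx mul1r big1 => [|j /negbTE ->]; last by rewrite mul0r.
by rewrite big1 ?addr0 // => l _; rewrite mul0r.
Qed.

Lemma extended_power_sum (l : 'I_d) : extended_ideal (power_sum l.+1).
Proof.
exists (fun=> 0), (fun k => (k == l)%:R).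
rewrite big1 => [|j _]; last by rewrite mul0r.
rewrite (bigD1 l) //= eqxx mul1r big1 ?addr0 ?add0r // => k /negbTE ->.
by rewrite mul0r.
Qed.

(** Over a domain in which this ideal vanishes, the x_j have multiplicities
    divisible by n / d, hence at most d distinct values, and d vanishing
    power sums. *)
Lemma xvar_nilpotent i : exists N, extended_ideal (x i ^+ N).
Proof.
apply: (nilpotent_mod_ideal ideal_extended) => K phi hphi.
have chK := pchar_morph phi ch.
have cnt y : (n %/ d %| count_mem y (codom (phi \o x)))%N.
  apply/(multiple_count _ _ n0).
  by apply: (singular_roots_multiplicityP phi ch r0 n0).1 => j; apply/hphi/extended_singular.
have sz : (size (undup (codom (phi \o x))) <= d)%N.
  have := size_undup_blocks cnt; rewrite size_codom card_ord.
  have En : n = (d * (n %/ d))%N by rewrite mulnC divnK // dvdn_gcdr.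
  by move=> /leq_trans/(_ (eq_leq En)); rewrite leq_pmul2r // block_size_gt0.
apply: (power_sums_zero (w := phi \o x) chK) => l lS.
have ld : (l < d)%N by apply: leq_trans sz.
have := hphi _ (extended_power_sum (Ordinal ld)).
rewrite /power_sum rmorph_sum /= => E; rewrite -[RHS]E.
by apply: eq_bigr => j _; rewrite rmorphXn.
Qed.

Lemma xvar_nilpotent_uniform : exists N, forall i, extended_ideal (x i ^+ N).
Proof.
have [N hN] := choice xvar_nilpotent.
exists (\max_i N i)%N => i; rewrite -(subnK (leq_bigmax i)) exprD.
exact: (idealM ideal_extended).
Qed.

(** The homogeneous component of a multiple of a homogeneous G is a multiple of
    G by a homogeneous polynomial. *)
Lemma pihomog_mul N D (G h : A) : G \is homog D ->
  exists h', [/\ hcomp N (h * G) = h' * G, h' \is homog (N - D) & (N < D)%N -> h' = 0].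
Proof.
move=> hG; exists (\sum_(k < msize h | (k + D == N)%N) hcomp k h); split.
- rewrite {1}(@pihomog_partitionE n F (@mdeg n) (msize h) h) // mulr_suml.
  rewrite (raddf_sum (hcomp N)) mulr_suml [RHS]big_mkcond; apply: eq_bigr => k _ /=.
  have hk := dhomogM (@pihomogP n F (@mdeg n) k h) hG.
  by case: eqP => [<-|/eqP ne]; [rewrite pihomog_dE | rewrite (pihomog_ne0 ne hk)].
- apply: rpred_sum => k /eqP <-; rewrite addnK; exact: pihomogP.
- by move=> ND; rewrite big1 // => k /eqP E; move: ND; rewrite -E ltnNge leq_addl.
Qed.

Lemma xvarX_homog i l : x i ^+ l \is homog l.
Proof. by have := dhomogMn l (xvar_homog F i); rewrite mul1n. Qed.

Lemma power_sum_homog l : power_sum l \is homog l.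
Proof. by apply: rpred_sum => j _; apply: xvarX_homog. Qed.

(** Taking homogeneous components bounds the degrees of the cofactors of the
    power sums, which is what makes the reduction of [homog_span]
    terminate. *)
Lemma xvar_nilpotent_homog : exists N, forall i,
  exists (g : 'I_n -> A) (h : 'I_d -> A),
    [/\ x i ^+ N = \sum_j g j * f j + \sum_l h l * power_sum l.+1,
        forall l, h l \is homog (N - l.+1) & forall l : 'I_d, (N < l.+1)%N -> h l = 0].
Proof.
have [N hN] := xvar_nilpotent_uniform; exists N => i.
have [g [h E]] := hN i.
have fh j : f j \is homog r.
  by rewrite dunkl_singularE // rpredN; apply: pole_coef_homog.
have [g' hg'] := choice (fun j => pihomog_mul N (g j) (fh j)).
have [h' hh'] := choice (fun l : 'I_d => pihomog_mul N (h l) (power_sum_homog l.+1)).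
exists g', h'; split; last 2 first.
- by move=> l; have [] := hh' l.
- by move=> l; have [] := hh' l.
rewrite -(pihomog_dE (xvarX_homog i N)) E raddfD !(raddf_sum (hcomp N)) /=.
by congr (_ + _); apply: eq_bigr => k _; [have [] := hg' k | have [] := hh' k].
Qed.

End Nilpotency.

(** * A spanning set of the quotient *)

Section SpanModulo.
Context (F : fieldType) (n : nat).
Local Notation A := (mpoly n F).
Variable I : set A.

(** The linear span of s and I. *)
Inductive span_mod (s : seq A) : A -> Prop :=
| span_mod_ideal p : I p -> span_mod s p
| span_mod_gen p : p \in s -> span_mod s p
| span_modD p q : span_mod s p -> span_mod s q -> span_mod s (p + q)
| span_modZ a p : span_mod s p -> span_mod s (a *: p).

Lemma span_mod_trans s s' : (forall p, p \in s -> span_mod s' p) ->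
  forall p, span_mod s p -> span_mod s' p.
Proof.
move=> H p; elim=> [q Iq|q /H //|q q' _ hq _ hq'|a q _ hq].
- exact: span_mod_ideal.
- exact: span_modD.
- exact: span_modZ.
Qed.

Hypotheses (I0 : I 0) (ID : forall p q, I p -> I q -> I (p + q))
  (IZ : forall a p, I p -> I (a *: p)).

Lemma span_mod_sum s (J : Type) (t : seq J) (P : pred J) (g : J -> A) :
  (forall j, P j -> span_mod s (g j)) -> span_mod s (\sum_(j <- t | P j) g j).
Proof.
move=> h; elim/big_ind: _ => //; first exact: span_mod_ideal.
exact: span_modD.
Qed.

Lemma span_mod_coef s p : span_mod s p ->
  exists c : 'rV[F]_(size s), I (p - \sum_i c 0 i *: s`_i).
Proof.
elim=> [q Iq|q qs|q q' _ [c hc] _ [c' hc']|a q _ [c hc]].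
- by exists 0; rewrite big1 ?subr0 // => i _; rewrite mxE scale0r.
- have iq : (index q s < size s)%N by rewrite index_mem.
  exists (delta_mx 0 (Ordinal iq)); rewrite (bigD1 (Ordinal iq)) //= mxE !eqxx scale1r.
  rewrite big1 ?addr0 ?nth_index ?subrr // => i /negbTE ni.
  by rewrite mxE ni andbF scale0r.
- exists (c + c'); under eq_bigr do rewrite mxE scalerDl.
  by rewrite big_split opprD addrACA; apply: ID.
- exists (a *: c); under eq_bigr do rewrite mxE -scalerA.
  by rewrite -scaler_sumr -scalerBr; apply: IZ.
Qed.

(** A family of more than size s' elements has a nontrivial linear relation
    between the coordinates of its elements with respect to s'. *)
Lemma dim_mod_le s s' : (forall p, p \in s -> span_mod s' p) ->
  (dim_mod I s <= size s')%N.
Proof.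
move=> H; apply/bigmax_leqP => B /asboolP freeB.
have [c hc] := choice (fun t : 'I_(size s) => span_mod_coef (H _ (mem_nth 0 (ltn_ord t)))).
rewrite leqNgt; apply/negP => lt.
(* a left kernel vector of the matrix of coordinates is a relation *)
pose M := \matrix_(t < #|B|) c (enum_val t).
have : (\rank (kermx M) != 0)%N.
  by rewrite mxrank_ker -lt0n subn_gt0 (leq_ltn_trans (rank_leq_col M)).
rewrite mxrank_eq0 => /rowV0Pn [v /sub_kermxP vM v0].
have [t0 Bt0] : exists t0, t0 \in B by apply/card_gt0P; apply: leq_ltn_trans lt.
pose e t := v 0 (enum_rank_in Bt0 t).
have e0 t : t \in B -> e t = 0.
  apply: (freeB e).
  have -> : \sum_(t in B) e t *: s`_t =
      \sum_(t in B) e t *: (s`_t - \sum_i c t 0 i *: s'`_i).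
    under [RHS]eq_bigr do rewrite scalerBr scaler_sumr.
    rewrite sumrB exchange_big /= [X in _ - X]big1 ?subr0 // => i _.
    under eq_bigr do rewrite scalerA.
    rewrite -scaler_suml [\sum_(t in B) _]big_enum_val /=.
    have := congr1 (fun w : 'rV_(size s') => w 0 i) vM; rewrite !mxE => E.
    rewrite (_ : \sum_(k < #|B|) _ = 0) ?scale0r // -[RHS]E.
    by apply: eq_bigr => k _; rewrite mxE /e enum_valK_in.
  by elim/big_ind: _ => // k _; apply/IZ/hc.
move/eqP: v0; apply; apply/rowP => k; rewrite mxE.
by rewrite -(e0 _ (enum_valP k)) /e enum_valK_in.
Qed.

(** An independent family of elements of s has distinct values, and thus defines
    a set of positions in s. *)
Lemma dim_mod_ge s (T : finType) (g : T -> A) : (forall t, g t \in s) ->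
  (forall c : T -> F, I (\sum_t c t *: g t) -> forall t, c t = 0) ->
  (#|T| <= dim_mod I s)%N.
Proof.
move=> gs indep.
have ilt t : (index (g t) s < size s)%N by rewrite index_mem.
pose idx t := Ordinal (ilt t).
have nth_idx t : s`_(idx t) = g t by rewrite nth_index.
have g_inj : injective g.
  move=> t t' E; apply/eqP/negPn/negP => tt.
  have := indep (fun k => (k == t)%:R - (k == t')%:R).
  have -> : \sum_k ((k == t)%:R - (k == t')%:R) *: g k = 0.
    under eq_bigr do rewrite scalerBl.
    rewrite sumrB (bigD1 t) //= [X in _ - X](bigD1 t') //= !eqxx !scale1r E.
    rewrite !big1 ?addr0 ?subrr // => k /negbTE ->; exact: scale0r.
  by move=> /(_ I0 t) /eqP; rewrite eqxx (negbTE tt) subr0 oner_eq0.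
have idx_inj : injective idx.
  by move=> t t' /(congr1 (fun i : 'I_(size s) => s`_i)); rewrite !nth_idx => /g_inj.
rewrite -cardsT -(card_imset _ idx_inj).
apply: (leq_bigmax_cond (F := fun B : {set 'I_(size s)} => #|B|)).
apply/asboolP => c; rewrite big_imset /=; last by move=> ? ? _ _; apply: idx_inj.
rewrite (eq_bigl predT) => [|t]; last by rewrite inE.
under eq_bigr do rewrite nth_idx.
by move=> /(indep (c \o idx)) c0 _ /imsetP [t _ ->]; apply: c0.
Qed.

End SpanModulo.

Section Spanning.
Context (F : fieldType) (n r : nat).
Hypotheses (ch : [pchar F] =i pred0) (r0 : (0 < r)%N) (n0 : (0 < n)%N).
Local Notation A := (mpoly n F).
Local Notation x := (@xvar F n).
Local Notation f := (@dunkl_singular F n r).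
Local Notation d := (gcdn r n).
Local Notation homog t := (@ishomog1 n F t (@mdeg n)).
Local Notation cent := (@center F n).
Local Notation I := (@ideal_I F n r).
Local Notation pow_sum l := (@power_sum F n l).

(** The power sums start at p_2, because p_1 vanishes on centred variables. *)
Definition standard_monomial (e : 'I_d.-1 -> nat) (u : 'I_n -> nat) : A :=
  (\prod_(l < d.-1) cent (pow_sum l.+2) ^+ e l) * \prod_i cent (x i) ^+ u i.

Definition bounded_monomial M N (e : {ffun 'I_d.-1 -> 'I_M.+1}) (u : {ffun 'I_n -> 'I_N}) :=
  standard_monomial (fun l => e l) (fun i => u i).

Definition standard_monomials M N : seq A :=
  [seq bounded_monomial e u | e <- enum {: {ffun 'I_d.-1 -> 'I_M.+1}},
                              u <- enum {: {ffun 'I_n -> 'I_N}}].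

Lemma standard_monomialsP M N p :
  reflect (exists e u, [/\ forall l, (e l <= M)%N, forall i, (u i < N)%N &
             p = standard_monomial e u])
    (p \in standard_monomials M N).
Proof.
apply: (iffP allpairsP) => [[[e u] /= [_ _ ->]]|[e [u [he hu ->]]]].
  by exists (fun l => e l : nat), (fun i => u i : nat); split=> // l; rewrite -ltnS.
exists ([ffun l => Ordinal (he l : (e l < M.+1)%N)], [ffun i => Ordinal (hu i)]).
rewrite !mem_enum; split=> //=; congr (_ * _); apply: eq_bigr => k _; by rewrite ffunE.
Qed.

Lemma size_standard_monomials M N :
  size (standard_monomials M N) = (M.+1 ^ d.-1 * N ^ n)%N.
Proof. by rewrite size_allpairs -!cardE !card_ffun !card_ord. Qed.

Lemma standard_monomials_le M M' N p : (M <= M')%N ->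
  p \in standard_monomials M N -> p \in standard_monomials M' N.
Proof.
move=> MM /standard_monomialsP [e [u [he hu ->]]]; apply/standard_monomialsP.
by exists e, u; split=> // l; apply: leq_trans MM.
Qed.

Lemma center_power_sum1 : cent (pow_sum 1) = 0.
Proof.
rewrite /power_sum (rmorph_sum cent) /=.
under eq_bigr do rewrite expr1 centerX.
rewrite sumrB sumr_const card_ord /mean -scaler_nat scalerA divff ?scale1r ?subrr //.
by have /pcharf0P -> := ch; rewrite -lt0n.
Qed.

Lemma span_mod_power_sum M N (l : 'I_d) p :
  span_mod I (standard_monomials M N) p ->
  span_mod I (standard_monomials M.+1 N) (cent (pow_sum l.+1) * p).
Proof.
elim=> [q Iq|q /standard_monomialsP [e [u [he hu ->]]]|q q' _ hq _ hq'|a q _ hq].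
- by apply/span_mod_ideal/ideal_IM => //; apply: transl_inv_center.
- case: l => -[|l] ld /=.
    rewrite center_power_sum1 mul0r; apply/span_mod_ideal/ideal_I0.
  have ld' : (l < d.-1)%N by rewrite -ltnS prednK ?gcdn_gt0 ?r0.
  apply/span_mod_gen/standard_monomialsP.
  exists (fun k => (e k + (k == Ordinal ld'))%N), u; split=> // [k|].
    by rewrite -addn1 leq_add // leq_b1.
  rewrite /standard_monomial mulrA; congr (_ * _).
  under [RHS]eq_bigr do rewrite exprD.
  rewrite big_split /= mulrC; congr (_ * _).
  rewrite (bigD1 (Ordinal ld')) //= eqxx big1 ?mulr1 // => k /negbTE ->.
  by [].
- by rewrite mulrDr; apply: span_modD.
- by rewrite -scalerAr; apply: span_modZ.
Qed.

Lemma center_ideal (g : 'I_n -> A) : I (cent (\sum_j g j * f j)).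
Proof.
rewrite (rmorph_sum cent); apply: ideal_I_sum => j _.
rewrite (rmorphM cent) /= [X in _ * X]center_id //; last exact: transl_inv_singular.
by apply: ideal_IM; [exact: transl_inv_center | exact: ideal_I_singular].
Qed.

(** A monomial in which some exponent is at least N is rewritten with the
    expression of x_i^N: the terms in the f_j belong to the ideal, and each
    other term is a power sum times a polynomial of smaller degree.  A power
    sum is thus extracted at most m times. *)
Lemma homog_span : exists N, forall m p, p \is homog m ->
  span_mod I (standard_monomials m N) (cent p).
Proof.
have [N hN] := xvar_nilpotent_homog ch r0 n0; exists N.
elim/ltn_ind => m IH p /dhomogP hp.
have monomial (a : multinom n) : mdeg a = m ->
    span_mod I (standard_monomials m N) (cent (mpolyX F a)).
  move=> am; have [i Ni|small] := pickP (fun i => N <= a i)%N; last first.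
    apply/span_mod_gen/standard_monomialsP; exists (fun=> 0%N), a; split=> // [i|].
      by rewrite ltnNge small.
    rewrite /standard_monomial big1 ?mul1r => [|l _]; last by rewrite expr0.
    rewrite mpolyXE_id (rmorph_prod cent) /=; apply: eq_bigr => i _.
    exact: (rmorphXn cent).
  (* the monomial of exponent a is x_i^N times the one of exponent b *)
  pose b := mnm_sub a (mnm_muln (mnm1 i) N).
  have Ea : a = mnm_add b (mnm_muln (mnm1 i) N).
    rewrite submK //; apply/mnm_lepP => j; rewrite mulmnE mnm1E.
    by case: eqP => [<-|_]; rewrite ?mul1n ?mul0n.
  have dm : (mdeg b + N = m)%N by rewrite -am Ea mdegD mdegMn mdeg1 mul1n.
  have -> : mpolyX F a = x i ^+ N * mpolyX F b.
    by rewrite {1}Ea mpolyXD -mpolyXn mulrC.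
  have [g [h [-> hh h0]]] := hN i.
  rewrite mulrDl !mulr_suml (rmorphD cent); apply: span_modD.
    apply: span_mod_ideal.
    under eq_bigr do rewrite mulrAC.
    exact: center_ideal.
  rewrite (rmorph_sum cent). apply: (span_mod_sum (I := I) (ideal_I0 _ _ _)) => l _.
  rewrite mulrAC mulrC /= (rmorphM cent) /=.
  case: (ltnP N l.+1) => [Nl|lN].
    by rewrite h0 // mul0r (rmorph0 cent) mulr0; apply/span_mod_ideal/ideal_I0.
  have mS : m = (m.-1).+1 by rewrite prednK // -dm addnC ltn_addr // (leq_trans _ lN).
  rewrite [m in standard_monomials m]mS; apply: span_mod_power_sum.
  have hom : h l * mpolyX F b \is homog (N - l.+1 + mdeg b).
    by apply: dhomogM => //; rewrite dhomogX.
  apply: span_mod_trans (IH _ _ _ hom) => [q qs|].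
    by apply/span_mod_gen/(standard_monomials_le _ qs); lia.
  by lia.
rewrite [p]mpolyE (rmorph_sum cent) big_seq.
apply: (span_mod_sum (I := I) (ideal_I0 _ _ _)) => /= a ap.
rewrite /center translateZ; apply: span_modZ; apply: monomial.
exact: hp.
Qed.

Lemma center_span : exists N, forall m p, (mmeasure (@mdeg n) p <= m.+1)%N ->
  span_mod I (standard_monomials m N) (cent p).
Proof.
have [N hN] := homog_span; exists N => m p pm.
rewrite (pihomog_partitionE pm) (rmorph_sum cent).
apply: (span_mod_sum (I := I) (ideal_I0 _ _ _)) => k _ /=.
apply: span_mod_trans (hN _ _ (pihomogP (@mdeg n) k p)) => q qs.
by apply/span_mod_gen/(standard_monomials_le _ qs); rewrite -ltnS.
Qed.

End Spanning.

(** * Growth of the quotient *)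

Section Growth.
Context (F : fieldType) (n r : nat).
Hypotheses (ch : [pchar F] =i pred0) (r0 : (0 < r)%N) (n0 : (0 < n)%N).
Local Notation A := (mpoly n F).
Local Notation x := (@xvar F n).
Local Notation f := (@dunkl_singular F n r).
Local Notation d := (gcdn r n).
Local Notation I := (@ideal_I F n r).
Local Notation tinv := (@transl_inv F n).
Local Notation msz p := (mmeasure (@mdeg n) p).

Lemma power_familyS (w e : seq A) m p : p \in power_family w e m.+1 ->
  exists a b, [/\ a \in 1 :: w, b \in power_family w e m & p = a * b].
Proof. by move=> /allpairsP [[a b] /= [ha hb ->]]; exists a, b. Qed.

Lemma power_family_inv (w e : seq A) m : (forall p, p \in w -> tinv p) ->
  (forall p, p \in e -> tinv p) -> forall p, p \in power_family w e m -> tinv p.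
Proof.
move=> hw he; elim: m => [//|m IH] p /power_familyS [a [b [ha hb ->]]].
apply: transl_invM; last exact: IH.
by move: ha; rewrite inE => /orP[/eqP ->|/hw //]; apply: transl_inv1.
Qed.

Lemma power_family_msize (w e : seq A) : exists k l, forall m p,
  p \in power_family w e m -> (msz p <= m * k + l)%N.
Proof.
pose K := (\max_(a <- 1%R :: w) msz a)%N.
exists K.+1, (\max_(b <- e) msz b)%N; elim=> [|m IH] p.
  by move=> pe; rewrite mul0n; apply: leq_bigmax_seq.
move=> /power_familyS [a [b [ha hb ->]]].
apply: leq_trans (msizeM_le a b) _.
have := IH b hb; have : (msz a <= K)%N by apply: leq_bigmax_seq.
by rewrite mulSn; lia.
Qed.

Lemma dim_mod_upper (w e : seq A) : (forall p, p \in w -> tinv p) ->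
  (forall p, p \in e -> tinv p) ->
  exists K, forall m, (0 < m)%N -> (dim_mod I (power_family w e m) <= K * m ^ d.-1)%N.
Proof.
move=> hw he; have [N hN] := center_span ch r0 n0.
have [k [l hkl]] := power_family_msize w e.
exists ((k + l).+1 ^ d.-1 * N ^ n)%N => m m0.
apply: (@leq_trans (size (@standard_monomials F n r (m * k + l) N))).
  apply: dim_mod_le; [exact: ideal_I0 | exact: ideal_ID | exact: ideal_IZ|].
  move=> p hp; rewrite -(center_id ch (power_family_inv hw he hp)).
  by apply: hN; apply: leq_trans (hkl _ _ hp) _.
rewrite size_standard_monomials mulnAC leq_mul2r -expnMn.
apply/orP; right; case: d.-1 => [|q]; first by rewrite !expn0.
by rewrite leq_exp2r //; nia.
Qed.

Local Notation b := (n %/ d)%N.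

(** The difference of the value on block t + 1 and of the value on block 0;
    these d - 1 functions are coordinates on the block subspace. *)
Definition coordinate (t : 'I_d.-1) : A := x (insubd (Ordinal n0) (t.+1 * b)%N) -
  x (Ordinal n0).

Definition coordinate_monomial (e : 'I_d.-1 -> nat) : A := \prod_t coordinate t ^+ e t.

(** Products of distinct coordinates are included, so that the m-th power of the
    generating space contains all the monomials with exponents at most m. *)
Definition coordinate_family : seq A :=
  [seq coordinate_monomial (fun t => e t) | e : {ffun 'I_d.-1 -> bool}].

Lemma coordinate_monomial_inv e : tinv (coordinate_monomial e).
Proof.
rewrite /coordinate_monomial; elim/big_ind: _ => [|p q|t _].
- exact: transl_inv1.
- exact: transl_invM.
- exact/transl_invX/transl_inv_sub.
Qed.

Lemma coordinate_monomial_mem m (e : 'I_d.-1 -> nat) : (forall t, (e t <= m)%N) ->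
  coordinate_monomial e \in power_family coordinate_family [:: 1] m.
Proof.
elim: m e => [|m IH] e he.
  rewrite inE /coordinate_monomial big1 // => t _.
  by have := he t; rewrite leqn0 => /eqP ->; rewrite expr0.
apply/allpairsP; exists (coordinate_monomial (fun t => (0 < e t)%N),
  coordinate_monomial (fun t => (e t).-1)).
split=> /=.
- rewrite inE; apply/orP; right; apply/mapP; exists [ffun t => (0 < e t)%N].
    by rewrite mem_enum.
  by apply: eq_bigr => t _; rewrite ffunE.
- by apply: IH => t; have := he t; case: (e t).
- rewrite /coordinate_monomial -big_split; apply: eq_bigr => t _ /=.
  by rewrite -exprD; case: (e t).
Qed.

Local Notation B := (mpoly d.-1 F).

Definition block_coordinate (i : 'I_n) : B :=
  if (i %/ b)%N is k.+1 then (if insub k is Some t then @xvar F d.-1 t else 0) else 0.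

(** The restriction to the points that are 0 on block 0 and have independent
    values on the other blocks.  These are generic points of the block
    subspace, with coordinates in a polynomial ring. *)
Definition block_restriction : A -> B := mmap (@mpolyC d.-1 F) block_coordinate.
HB.instance Definition _ := GRing.RMorphism.on block_restriction.

Lemma block_restrictionX i : block_restriction (x i) = block_coordinate i.
Proof. by rewrite /block_restriction mmapX mmap1U. Qed.

Lemma block_restriction_singular j : block_restriction (f j) = 0.
Proof.
apply: (singular_roots_multiplicityP block_restriction ch r0 n0).2 => y.
apply/(multiple_count _ _ n0)/block_count; first exact: block_size_dvd.
by move=> i i' ii; rewrite /= !block_restrictionX /block_coordinate ii.
Qed.

Lemma block_restriction_ideal p : I p -> block_restriction p = 0.
Proof.
move=> [g _ ->]; rewrite (rmorph_sum block_restriction) big1 // => i _.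
by rewrite /= (rmorphM block_restriction) /= block_restriction_singular mulr0.
Qed.

Lemma block_restriction_coordinate t : block_restriction (coordinate t) = @xvar F d.-1 t.
Proof.
have b0 : (0 < b)%N := block_size_gt0 r n0.
have tb : (t.+1 * b < n)%N.
  have En : (d * b = n)%N by rewrite mulnC divnK // dvdn_gcdr.
  by rewrite -[ltnRHS]En ltn_pmul2r // -ltn_predRL.
rewrite /coordinate (rmorphB block_restriction) /= !block_restrictionX.
rewrite /block_coordinate val_insubd tb mulnK // div0n subr0.
by rewrite insubT.
Qed.

Lemma dim_mod_lower m :
  (m.+1 ^ d.-1 <= dim_mod I (power_family coordinate_family [:: 1%R] m))%N.
Proof.
have -> : (m.+1 ^ d.-1 = #|{: {ffun 'I_d.-1 -> 'I_m.+1}}|)%N by rewrite card_ffun !card_ord.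
apply: (dim_mod_ge (I := I) (ideal_I0 _ _ _)
  (g := fun t : {ffun 'I_d.-1 -> 'I_m.+1} => coordinate_monomial (fun k => t k))).
  by move=> t; apply: coordinate_monomial_mem => k; rewrite -ltnS.
move=> c /block_restriction_ideal.
rewrite (rmorph_sum block_restriction) => E t.
pose mon (t : {ffun 'I_d.-1 -> 'I_m.+1}) := Multinom [tuple (t k : nat) | k < d.-1].
have mon_inj : injective mon.
  move=> u v /mnmP uv; apply/ffunP => k; apply/val_inj.
  by have := uv k; rewrite !mnmE.
have Eu u : block_restriction (c u *: coordinate_monomial (fun k => u k)) =
      c u *: mpolyX F (mon u).
  rewrite -mul_mpolyC (rmorphM block_restriction) /= /block_restriction mmapC
    mul_mpolyC -/block_restriction.
  congr (_ *: _); rewrite (rmorph_prod block_restriction) mpolyXE_id; apply: eq_bigr => k _.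
  by rewrite (rmorphXn block_restriction) /= block_restriction_coordinate mnmE.
have := congr1 (mcoeff (mon t)) E; rewrite (raddf_sum (mcoeff (mon t))) mcoeff0.
rewrite (bigD1 t) //= Eu mcoeffZ mcoeffX eqxx mulr1 big1 ?addr0 // => u ut.
by rewrite /= Eu mcoeffZ mcoeffX (inj_eq mon_inj) (negbTE ut) mulr0.
Qed.

End Growth.

(** * Growth exponents and the theorem *)

Section GrowthExponent.
Context (R : realType).
Implicit Types (a : nat -> nat) (q K m : nat).

Local Notation exponent a := (fun m => lne (a m)%:R%:E * ((ln m%:R)^-1)%:E : \bar R)%E.

Lemma ln_natr_gt0 m : (1 < m)%N -> 0 < ln m%:R :> R.
Proof. by move=> m1; rewrite ln_gt0 // ltr1n. Qed.

(** The constant K contributes ln K / ln m, which tends to 0.  It is replaced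
    by K + 1 because K may be 0. *)
Lemma growth_exponent_le a K q :
  (forall m, (0 < m)%N -> (a m <= K * m ^ q)%N) ->
  (limn_esup (exponent a) <= q%:R%:E)%E.
Proof.
move=> H; apply/lee_addgt0Pr => eps e0.
pose C := ln K.+1%:R : R.
(* beyond m0, ln (K + 1) <= eps ln m *)
pose m0 := (Num.truncn (expR (C / eps))).+2.
have big m : (m0 <= m)%N -> C <= eps * ln m%:R.
  move=> mm; have m1 : (1 < m)%N by apply: leq_trans mm.
  rewrite mulrC -ler_pdivrMr // -ler_expR lnK ?posrE ?ltr0n 1?ltnW //.
  apply: le_trans (_ : m0%:R <= _); last by rewrite ler_nat.
  by apply/ltW; apply: lt_le_trans (truncnS_gt _) _; rewrite ler_nat.
apply: (@le_trans _ _ (ereal_sup (exponent a @` [set m | (m0 <= m)%N]))).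
  by apply: ereal_inf_lbound; exists [set m | (m0 <= m)%N] => //; exists m0.
apply: ge_ereal_sup => _ [m mm <-].
rewrite -[leLHS]/(lne (a m)%:R%:E * ((ln m%:R)^-1)%:E)%E; rewrite /= in mm.
have m1 : (1 < m)%N by apply: leq_trans mm.
have lm := ln_natr_gt0 m1.
have [a0|a0] := posnP (a m).
  by rewrite a0 le0_lneNy // mulNyr gtr0_sg ?invr_gt0 // mul1e leNye.
rewrite lne_EFin ?ltr0n // -EFinM -EFinD lee_fin ler_pdivrMr //.
apply: (@le_trans _ _ (ln (K.+1 * m ^ q)%:R)).
  rewrite ler_ln ?posrE ?ltr0n ?muln_gt0 ?expn_gt0 ?(ltnW m1) //.
  by rewrite ler_nat (leq_trans (H _ (ltnW m1))) // leq_mul2r leqnSn orbT.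
rewrite natrM natrX lnM ?posrE ?exprn_gt0 ?ltr0n ?(ltnW m1) //.
rewrite lnXn ?ltr0n ?(ltnW m1) // -/C mulrDl addrC mulr_natl lerD2l.
exact: big.
Qed.

Lemma growth_exponent_ge a q : (forall m, (m.+1 ^ q <= a m)%N) ->
  (q%:R%:E <= limn_esup (exponent a))%E.
Proof.
move=> H; apply: le_ereal_inf_tmp => _ [V [m0 _ mV] <-].
pose m := maxn m0 2.
have m1 : (1 < m)%N by rewrite leq_max orbT.
have lm := ln_natr_gt0 m1.
apply: (@le_trans _ _ (lne (a m)%:R%:E * ((ln m%:R)^-1)%:E)%E); last first.
  by apply: ereal_sup_ubound; exists m => //; apply: mV; rewrite /= leq_maxl.
have am : (m ^ q <= a m)%N.
  by apply: leq_trans (H m); case: (q) => // q'; rewrite leq_exp2r.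
have mq : (0 < m ^ q)%N by rewrite expn_gt0 (ltnW m1).
rewrite lne_EFin ?ltr0n ?(leq_trans mq) // -EFinM lee_fin ler_pdivlMr //.
rewrite mulr_natl -lnXn ?ltr0n ?(ltnW m1) // -natrX.
by rewrite ler_ln ?posrE ?ltr0n ?(leq_trans mq) // ler_nat.
Qed.

End GrowthExponent.

Section GelfandKirillov.
Context (R : realType) (n r : nat).
Hypotheses (r0 : (0 < r)%N) (n0 : (0 < n)%N).

Lemma gk_dimE : gk_dim (@transl_inv R[i] n) (@submodule_I R[i] n r) = ((gcdn r n)%:R - 1)%:E.
Proof.
have ch : [pchar R[i]] =i pred0 := pchar_num _.
have -> : (gcdn r n)%:R - 1 = (gcdn r n).-1%:R :> R.
  by rewrite -subn1 natrB // gcdn_gt0 r0.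
rewrite submodule_IE // /gk_dim; apply/le_anti/andP; split.
  apply: ge_ereal_sup => _ [w [e [hw he ->]]].
  have [K hK] := dim_mod_upper ch r0 n0 hw he.
  exact: growth_exponent_le hK.
apply: le_trans (growth_exponent_ge _ (dim_mod_lower ch r0 n0)) _.
apply: ereal_sup_ubound; exists (coordinate_family R[i] r n0), [:: 1%R]; split=> //.
  by move=> p /mapP [t _ ->]; apply: coordinate_monomial_inv.
by move=> p; rewrite inE => /eqP ->; apply: transl_inv1.
Qed.

End GelfandKirillov.

Theorem theorem3p2 (R : realType) (n r : nat)
    (hn : (2 <= n)%N) (hr : (0 < r)%N) (hnr : ~~ (n %| r)%N) :
  let d := gcdn r n in
  let M : set (mpoly n R[i]) := @transl_inv R[i] n in
  let I : set (mpoly n R[i]) := @submodule_I R[i] n r in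
  quot_support M I =
    \bigcup_(s in [set: 'S_n]) (act_hspace s @` @block_subspace R[i] n d)
  /\ gk_dim M I = (d%:R - 1)%:E.
Proof.
have n0 : (0 < n)%N by apply: ltnW.
split; last exact: gk_dimE.
by apply: quot_supportE => //; apply: pchar_num.
Qed.
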